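(* Let $\mathbb{F}_q$ be a fixed finite field with $q$ odd and $q\equiv 1 \pmod 4$. Then for every $\varepsilon>0$, as $g\to\infty$, $$\sum_{\substack{P \text{ monic irreducible}\\ \deg P=2g+1}}(\log_q|P|)\,L(\tfrac12,\chi_P)=\frac{|P|}{2}\big(\log_q|P|+1\big)+O\big(|P|^{3/4+\varepsilon}\big),$$ where on the right-hand side $|P|=q^{2g+1}$ and $\log_q|P|=2g+1$.
   Context: $A=\mathbb{F}_q[T]$. For nonzero $f\in A$, $|f|=q^{\deg f}$. For a monic irreducible $Q\in A$ and $a\in A$, the quadratic residue symbol $\left(\frac{a}{Q}\right)$ equals $0$ if $Q\mid a$, $1$ if $a$ is a nonzero square modulo $Q$, and $-1$ otherwise; for monic $f=\prod_i Q_i^{e_i}$ (distinct monic irreducibles $Q_i$) one sets $\left(\frac{a}{f}\right)=\prod_i\left(\frac{a}{Q_i}\right)^{e_i}$, with $\left(\frac{a}{1}\right)=1$. For a monic irreducible $P$, $\chi_P(f)=\left(\frac{P}{f}\right)$ for monic $f$. For $P$ monic irreducible of odd degree $2g+1$, $L(s,\chi_P)=\sum_{f\text{ monic}}\chi_P(f)|f|^{-s}$ ($\Re s>1$) is a polynomial in $u=q^{-s}$ of degree $2g$ (the sum of $\chi_P(f)$ over monic $f$ of degree $n$ vanishes for $n\ge 2g+1$), i.e. $L(s,\chi_P)=\sum_{n=0}^{2g}\big(\sum_{f\text{ monic},\deg f=n}\chi_P(f)\big)u^n$, and $L(\tfrac12,\chi_P)$ denotes its value at $u=q^{-1/2}$.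 Implied constants may depend on $q$ and $\varepsilon$. *)

(* Defs.v *)
From Stdlib Require Import Reals.
From HB Require Import structures.
From mathcomp Require Import all_boot all_order all_algebra.
Set Implicit Arguments. Unset Strict Implicit. Unset Printing Implicit Defensive.
Import GRing.Theory.

Section Defs.
Variable F : finFieldType.
Local Open Scope ring_scope.

(* quadratic residue symbol (a/Q) for Q monic irreducible:
   0 if Q | a; 1 if a is a nonzero square mod Q (a = b^2 mod Q for some residue
   b, represented by a polynomial of degree < deg Q); -1 otherwise *)
Definition qr_symbol (a Q : {poly F}) : int :=
  if Q %| a then 0
  else if [exists b : {poly_((size Q).-1) F}, Q %| a - (val b) ^+ 2] then 1
  else -1.

(* multiplicity of Q in f: the largest e with Q^e | f (for f <> 0, deg Q >= 1) *)
Definition multiplicity (Q f : {poly F}) : nat :=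
  (\max_(e < size f) (if (Q ^+ e %| f)%R then (e : nat) else 0%N))%N.

(* Jacobi symbol (a/f) = prod over distinct monic irreducible Q | f of (a/Q)^{e_Q};
   the product ranges over all monic irreducible Q of degree <= deg f
   (those not dividing f have exponent 0). *)
Definition jacobi (a f : {poly F}) : int :=
  \prod_(Q : {poly_(size f) F} | (val Q \is monic) && irreducibleb (val Q))
     (qr_symbol a (val Q)) ^+ (multiplicity (val Q) f).

Definition chi (P f : {poly F}) : int := jacobi P f.

Definition char_sum (P : {poly F}) (n : nat) : int :=
  \sum_(f : {poly_(n.+1) F} | (val f \is monic) && (size (val f) == n.+1)%N)
     chi P (val f).

End Defs.

Definition int_to_R (z : int) : R :=
  match z with
  | Posz n => INR n
  | Negz n => Ropp (INR n.+1)
  end.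

Definition qR (F : finFieldType) : R := INR #|F|.

Definition L_half (F : finFieldType) (P : {poly F}) : R :=
  \big[Rplus/R0]_(n < (size P).-1)
     Rmult (int_to_R (char_sum P n)) (pow (Rinv (sqrt (qR F))) n).

Definition weighted_Lsum (F : finFieldType) (g : nat) : R :=
  \big[Rplus/R0]_(P : {poly_((2 * g + 1).+1) F} |
                    (val P \is monic) && (size (val P) == (2 * g + 1).+1)%N
                    && irreducibleb (val P))
     Rmult (INR (2 * g + 1)) (L_half (val P)).

(* Main.v *)
(** Write [q = #|F|], [N = 2g + 1] and [Q = q^N].

    Since [q = 1 mod 4], quadratic reciprocity turns [chi_P(f) = (P/f)] into
    [(f/P)], so that [chi_P] is a character modulo [P]; on constants it is the
    quadratic character of [F], because [deg P] is odd.  Let [a_n] be the sum of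
    [chi_P] over monic polynomials of degree [n].  Summing
    [chi_P(h) chi_P(top coefficient of f h mod P)] over monic [f] of degree [n]
    and over all residues [h] gives [tau a_n = q^n (q - 1) a_(2g-n)] with a
    constant [tau].  At [n = g] the integer [a_g] is odd, hence nonzero, so that
    [tau = q^g (q - 1)]: this is the functional equation, with its sign.
    Therefore [L(1/2, chi_P)] is the sum of [a_n q^(-n/2)] over [n <= g] plus the
    same sum over [n < g].

    Square [f] contribute the main term, since [N] times the number of primes of
    degree [N] is [Q] up to [g q^(g+1)].  For nonsquare [f] of degree [n <= g],
    Stepanov's method bounds the sum of [(f/P)] over the primes of degree [N].
    It is carried out in [F[X]] itself: the primes with [(f/P) = eps] have a
    product [D] dividing both [X^Q - X] and [f^((Q-1)/2) - eps], and an auxiliary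
    polynomial of small degree is divisible by a high power of [D].  Hasse
    derivatives are avoided by expanding in powers of [W = X^Q - X]: modulo
    [D^Q] one has [eps f^((Q-1)/2) = (f^(Q-1))^((Q+1)/2)], where
    [f^Q = f(X + W)]. *)

Require Import Defs.
From Stdlib Require Import Reals Lra.

(** * Growth of the error term *)

Section RealGrowth.
Local Open Scope R_scope.

(** Since [sqrt q ^ (3 * g)] is [q ^ (2 * g)] to the power 3/4, only the quadratic factor must be
    absorbed; [exp (2 * g * d)] with [d = eps * ln q] does it. *)
Lemma growth_bound (q eps : R) : 1 < q -> 0 < eps -> exists C, 0 <= C /\ forall g : nat,
  (INR g + 1) ^ 2 * sqrt q ^ (3 * g) <= C * Rpower (q ^ (2 * g + 1)) (3 / 4 + eps).
Proof.
intros q_gt1 eps_gt0.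
assert (lnq : 0 < ln q) by (rewrite <- ln_1; apply ln_increasing; lra).
set (d := eps * ln q).
assert (d_gt0 : 0 < d) by (apply Rmult_lt_0_compat; assumption).
(* Chosen so that [c * (1 + g * d) >= 1 + g], to be combined with [1 + x <= exp x]. *)
set (c := 1 + / d).
assert (c_gt0 : 0 < c) by (unfold c; pose proof (Rinv_0_lt_compat d d_gt0); lra).
exists (c ^ 2); split; [apply pow_le; lra|]; intros g.
assert (lin : INR g + 1 <= c * exp (INR g * d)).
{ pose proof (pos_INR g) as g_ge0.
  pose proof (exp_ineq1_le (INR g * d)) as e1.
  apply Rle_trans with (c * (1 + INR g * d)); [|apply Rmult_le_compat_l; lra].
  replace (c * (1 + INR g * d)) with (1 + INR g + (/ d + INR g * d)) by (unfold c; field; lra).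
  pose proof (Rinv_0_lt_compat d d_gt0).
  assert (0 <= INR g * d) by (apply Rmult_le_pos; lra). lra. }
assert (sq : sqrt q ^ (3 * g) = exp (INR g * (3 / 2 * ln q))).
{ rewrite <- Rpower_pow by (apply sqrt_lt_R0; lra).
  unfold Rpower; rewrite <- Rpower_sqrt by lra; unfold Rpower; rewrite ln_exp, mult_INR.
  f_equal; simpl; lra. }
assert (rhs : Rpower (q ^ (2 * g + 1)) (3 / 4 + eps) =
   exp ((3 / 4 + eps) * ((2 * INR g + 1) * ln q))).
{ unfold Rpower; rewrite ln_pow by lra; rewrite plus_INR, mult_INR; f_equal; simpl; lra. }
rewrite sq, rhs.
apply Rle_trans with ((c * exp (INR g * d)) ^ 2 * exp (INR g * (3 / 2 * ln q))).
{ apply Rmult_le_compat_r; [left; apply exp_pos|].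
  apply pow_incr; split; [pose proof (pos_INR g); lra | exact lin]. }
rewrite Rpow_mult_distr, Rmult_assoc.
apply Rmult_le_compat_l; [apply pow_le; lra|].
replace (exp (INR g * d) ^ 2) with (exp (2 * (INR g * d))).
2: { replace (2 * (INR g * d)) with (INR g * d + INR g * d) by ring. rewrite exp_plus; ring. }
rewrite <- exp_plus.
assert (ex : 2 * (INR g * d) + INR g * (3 / 2 * ln q) <= (3 / 4 + eps) * ((2 * INR g + 1) * ln q)).
{ unfold d. assert (0 < eps * ln q) by (apply Rmult_lt_0_compat; assumption). lra. }
destruct ex as [ex|ex]; [left; apply exp_increasing; exact ex | right; rewrite ex; reflexivity].
Qed.

End RealGrowth.

From HB Require Import structures.
From mathcomp Require Import all_boot all_order all_algebra all_field.
From mathcomp Require Import zify ring lra Rstruct.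
Set Implicit Arguments. Unset Strict Implicit. Unset Printing Implicit Defensive.
Import Order.TTheory GRing.Theory Num.Theory.
Local Open Scope ring_scope.

(** * Residue fields of F[X] *)

Section FinitePolynomials.
Variable F : finFieldType.
Local Notation q := #|F|.
Implicit Types (P Q f a b : {poly F}).

Lemma expf_card_iter (K : finFieldType) k (c : K) : c ^+ (#|K| ^ k) = c.
Proof. by elim: k => [|k IH]; rewrite ?expr1 // expnSr exprM IH expf_card. Qed.

Lemma pchar_nat_card k (R : nzRingType) :
  [pchar R] =i [pchar F] -> [pchar R].-nat (q ^ k)%N.
Proof.
move=> eqRF; have [p p_pr pF] := finPcharP F.
have pR : p \in [pchar R] by rewrite eqRF.
rewrite (eq_pnat _ (pcharf_eq pR)) pnatX; apply/orP; left.
by rewrite -[q]/#|pPrimeCharType pF| card_pprimeChar pnatX pnat_id.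
Qed.

Lemma natr_card_exp k : (0 < k)%N -> (q ^ k)%:R = 0 :> F.
Proof.
case: k => // k _; have [p p_pr pF] := finPcharP F.
apply/eqP; rewrite -(dvdn_pcharf pF) expnS dvdn_mulr //.
have := finNzRing_gt1 F.
rewrite -[q]/#|pPrimeCharType pF| card_pprimeChar; set m := logn _ _.
by case: m => // m _; rewrite expnS dvdn_mulr.
Qed.

Lemma two_neq0 : odd q -> 2%:R != 0 :> F.
Proof.
move=> oq; apply/eqP => H2; have := natr_card_exp (ltn0Sn 0).
rewrite expn1 -(odd_double_half q) oq natrD -mul2n natrM H2 mul0r addr0.
by move/eqP; rewrite oner_eq0.
Qed.

(** The Frobenius map is additive and fixes the coefficients. *)
Lemma exp_card_comp k f : f ^+ (q ^ k) = f \Po 'X^(q ^ k).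
Proof.
elim/poly_ind: f => [|f c IH].
  by rewrite comp_poly0 expr0n expn_eq0 eqn0Ngt ltnW ?finNzRing_gt1.
rewrite exprDn_pchar ?pchar_nat_card //; last exact: pchar_poly.
rewrite exprMn IH -rmorphXn /= expf_card_iter.
by rewrite comp_polyD comp_polyM comp_polyX comp_polyC.
Qed.

Lemma dvdp_comp_sub a b f : a - b %| (f \Po a) - (f \Po b).
Proof.
elim/poly_ind: f => [|f c IH]; first by rewrite !comp_poly0 subrr; apply: dvdp0.
rewrite !comp_polyD !comp_polyM !comp_polyX !comp_polyC.
have -> : (f \Po a) * a + c%:P - ((f \Po b) * b + c%:P) =
          ((f \Po a) - (f \Po b)) * a + (f \Po b) * (a - b).
  by ring.
by rewrite dvdp_add // ?(dvdp_mulr _ IH) // dvdp_mull.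
Qed.

Lemma dvdp_exp_card k f : 'X^(q ^ k) - 'X %| f ^+ (q ^ k) - f.
Proof. by rewrite exp_card_comp -{2}[f]comp_polyXr dvdp_comp_sub. Qed.

(** A square factor [Q ^+ 2] makes [Q] divide the derivative, which is [-1] in this
    characteristic. *)
Lemma sqr_ndvdp_frobenius k Q : (0 < k)%N -> Q ^+ 2 %| 'X^(q ^ k) - 'X -> Q %| 1.
Proof.
move=> k_gt0 /dvdpP[c Dc].
have : deriv ('X^(q ^ k) - 'X) = -1 :> {poly F}.
  by rewrite derivB derivXn derivX -mulr_natr -polyC_natr natr_card_exp // mulr0 sub0r.
rewrite Dc expr2 !derivM => /(congr1 -%R); rewrite opprK => <-.
rewrite dvdpNr (_ : _ + _ = (c^`() * Q + c * (Q^`() *+ 2)) * Q) ?dvdp_mull //.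
by ring.
Qed.

(** Congruences modulo [P] become equations in a field of known cardinality. Surjectivity is stated
    with reduced representatives because [qr_symbol] quantifies over those. *)
Lemma residue_field P : monic_irreducible_poly P ->
  {K : finFieldType & {red : {rmorphism {poly F} -> K} |
    [/\ #|K| = (q ^ (size P).-1)%N,
        forall a : {poly F}, (red a == 0) = (P %| a) &
        forall x : K, exists2 a : {poly F}, (size a <= (size P).-1)%N & red a = x]}}.
Proof.
move=> mi; exists {poly %/ P with mi}; exists (in_qpoly P); split.
- exact: card_qfpoly.
- by move=> a; rewrite -val_eqE /= mk_monicE // -Pdiv.IdomainMonic.modpE ?mi.
move=> x; exists (val x).
  by apply: leq_trans (size_npoly _) _; rewrite mk_monicE.
by apply: val_inj; rewrite /= [LHS]in_qpoly_small ?size_mk_monic.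
Qed.

Section Modulus.
Variable P : {poly F}.
Hypothesis P_mi : monic_irreducible_poly P.

Lemma dvdp_fermat : P %| 'X^(q ^ (size P).-1) - 'X.
Proof.
have [K [red [cK red0 _]]] := residue_field P_mi.
by rewrite -red0 rmorphB rmorphXn -cK expf_card subrr.
Qed.

(** All elements of the residue field become roots of ['X^(q ^ e) - 'X], whose degree bounds their
    number. *)
Lemma dvdp_frobenius_leq e :
  (0 < e)%N -> P %| 'X^(q ^ e) - 'X -> ((size P).-1 <= e)%N.
Proof.
move=> e_gt0 dv.
have [K [red [cK red0 red_surj]]] := residue_field P_mi.
have q_gt1 := finNzRing_gt1 F.
have all_root (x : K) : root ('X^(q ^ e) - 'X) x.
  rewrite rootE !hornerE subr_eq0; have [a _ <-] := red_surj x.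
  rewrite -rmorphXn -subr_eq0 -rmorphB red0 /=.
  by apply: dvdp_trans dv _; apply: dvdp_exp_card.
have sz : size ('X^(q ^ e) - 'X : {poly K}) = (q ^ e).+1.
  by rewrite size_polyDl ?size_polyXn // size_polyN size_polyX ltnS (leq_trans q_gt1) // -{1}(expn1 q) leq_exp2l.
have nz : 'X^(q ^ e) - 'X != 0 :> {poly K} by rewrite -size_poly_gt0 sz.
have := max_poly_roots nz (introT allP (fun x _ => all_root x)) (enum_uniq K).
by rewrite sz -cardE cK ltnS leq_exp2l.
Qed.

(** Raising to the power [q ^ deg P] is the identity on the residue field, so [e] may be replaced by
    its remainder modulo [deg P]; [dvdp_frobenius_leq] forces that remainder to vanish. *)
Lemma dvdp_frobenius_dvdn e : P %| 'X^(q ^ e) - 'X -> ((size P).-1 %| e)%N.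
Proof.
have [K [red [cK red0 _]]] := residue_field P_mi.
rewrite -red0 rmorphB rmorphXn subr_eq0 {1}(divn_eq e (size P).-1) mulnC expnD.
rewrite expnM -cK exprM expf_card_iter -rmorphXn -subr_eq0 -rmorphB red0 /= => dv.
have d_gt0 : (0 < (size P).-1)%N by have [[]] := P_mi; case: (size P) => [|[]].
rewrite /dvdn; case: posnP => // r_gt0.
by have := dvdp_frobenius_leq r_gt0 dv; rewrite leqNgt ltn_mod d_gt0.
Qed.

End Modulus.

(** The fibres of squaring have at most two elements, so there are at least [E] nonzero squares, all
    roots of ['X^E - 1]. A nonsquare root would be one root too many. *)
Lemma euler_criterion (K : finFieldType) (x : K) : odd #|K| -> x != 0 ->
  [exists y, x == y ^+ 2] = (x ^+ (#|K|.-1)./2 == 1).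
Proof.
move=> oK x0; set E := (_./2).
have K1 : #|K|.-1 = (E * 2)%N.
  rewrite muln2 /E; case: #|K| oK => //= n /negbTE on.
  by rewrite -[LHS]odd_double_half on.
have fermat (y : K) : y != 0 -> y ^+ (E * 2) = 1.
  move=> y0; apply: (mulfI y0); rewrite -exprS -K1 prednK ?expf_card ?mulr1 //.
  by apply/card_gt0P; exists 0.
apply/existsP/idP => [[y /eqP Dx]|xE].
  rewrite Dx -exprM mulnC fermat //.
  by apply: contraNneq x0 => y0; rewrite Dx y0 expr0n.
apply/existsP; apply: contraT; rewrite negb_exists => /forallP nsq.
pose S := [set y ^+ 2 | y in [set: K] & y != 0].
have cS : (E * 2 <= #|S| * 2)%N.
  rewrite -K1 -(cardC1 (0 : K)) -[#|predC1 _|]sum1_card.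
  rewrite (partition_big (fun y => y ^+ 2) (mem S)) /=; last first.
    by move=> y; rewrite !inE => y0; apply/imsetP; exists y; rewrite // !inE.
  rewrite -sum_nat_const leq_sum // => _ /imsetP[y _ ->].
  rewrite sum1_card (leq_trans _ (card_size [:: y; - y])) //.
  apply/subset_leq_card/subsetP => z; rewrite !inE unfold_in => /andP[_].
  by rewrite eqf_sqr.
have E_gt0 : (0 < E)%N.
  by rewrite -(ltn_pmul2r (ltn0Sn 1)) -K1 mul0n -ltnS prednK ?finNzRing_gt1 // ltnW ?finNzRing_gt1.
have nz : 'X^E - 1 != 0 :> {poly K} by rewrite -size_poly_gt0 size_XnsubC.
have rt : all (root ('X^E - 1)) (x :: enum S).
  apply/allP => z; rewrite inE mem_enum rootE !hornerE subr_eq0 => /orP[/eqP->//|].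
  by case/imsetP => y; rewrite inE => /andP[_ y0] ->; rewrite -exprM mulnC fermat.
have un : uniq (x :: enum S).
  rewrite /= enum_uniq andbT mem_enum; apply/imsetP => -[y _ Dx].
  by have := nsq y; rewrite Dx eqxx.
have := max_poly_roots nz rt un.
rewrite size_XnsubC // /= -cardE ltnS => lt.
by move: cS; rewrite leq_pmul2r // leqNgt lt.
Qed.

End FinitePolynomials.

(** * The quadratic symbol and reciprocity *)

Section QuadraticSymbol.
Variable F : finFieldType.
Local Notation q := #|F|.
Hypothesis q_odd : odd q.
Implicit Types (P Q f a b : {poly F}).

Definition sign_values : seq int := [:: 0; 1; -1].

(** Symbols are integers, whereas Euler's criterion gives equalities in a field; this brings the
    latter back to the integers. *)
Lemma sign_values_inj (L : fieldType) (y z : int) : 2%:R != 0 :> L ->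
  y \in sign_values -> z \in sign_values -> y%:~R = z%:~R :> L -> y = z.
Proof.
move=> n2; rewrite !inE.
by do 2![case/or3P=> /eqP->] => // H; case/eqP: n2; move/eqP: H;
  rewrite ?rmorphN1 ?rmorph1 ?rmorph0 ?oppr_eq0 ?[0 == _]eq_sym ?oppr_eq0 ?oner_eq0 //
    -subr_eq0 ?opprK -?opprD ?oppr_eq0 => /eqP.
Qed.

Lemma sign_valuesM y z : y \in sign_values -> z \in sign_values -> y * z \in sign_values.
Proof. by rewrite !inE; do 2![case/or3P=> /eqP->]. Qed.

Lemma qr_sign_values a Q : qr_symbol a Q \in sign_values.
Proof. by rewrite /qr_symbol; do 2?case: ifP. Qed.

Section Modulus.
Variable Q : {poly F}.
Hypothesis Q_mi : monic_irreducible_poly Q.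
Let E := ((q ^ (size Q).-1).-1)./2.

(** Euler's criterion as an equality in the residue field. The algebraic rules for the symbol follow
    from it through [sign_values_inj], which needs [2 != 0]. *)
Lemma qr_residue : {K : finFieldType & {red : {rmorphism {poly F} -> K} |
    [/\ 2%:R != 0 :> K,
        forall a : {poly F}, (red a == 0) = (Q %| a) &
        forall a : {poly F}, red a ^+ E = (qr_symbol a Q)%:~R]}}.
Proof.
have [K [red [cK red0 red_surj]]] := residue_field Q_mi.
have oK : odd #|K| by rewrite cK oddX q_odd orbT.
exists K, red; split => //; first exact: two_neq0.
move=> a; rewrite /qr_symbol /E -cK -red0; case: eqP => [->|/eqP a0].
  rewrite expr0n; have := finNzRing_gt1 K.
  by case: #|K| oK => [|[|[|n]]].
have fermat : red a ^+ #|K|.-1 = 1.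
  apply: (mulfI a0); rewrite -exprS prednK ?expf_card ?mulr1 //.
  by apply/card_gt0P; exists 0.
have := euler_criterion oK a0.
set e1 := [exists y, _]; set e2 := [exists b, _]; set h := (_./2).
have <- : e1 = e2.
  apply/existsP/existsP => [[y /eqP]|[b]].
    have [b sb <-] := red_surj y => Db; exists (npolyp _ b).
    by rewrite /= npolypK // -red0 rmorphB rmorphXn Db subrr.
  by rewrite -red0 rmorphB rmorphXn subr_eq0 => Db; exists (red (val b)).
have /eqP : (red a ^+ h) ^+ 2 = 1.
  rewrite -exprM muln2 -fermat; congr (_ ^+ _).
  rewrite -[RHS]odd_double_half /h; case: #|K| oK => //= n /negbTE -> //.
rewrite sqrf_eq1 => /orP[/eqP->|/eqP-> ->]; first by rewrite eqxx => ->.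
rewrite ifN //; apply: contra (two_neq0 oK) => /eqP H.
by rewrite mulr2n -{1}H addNr.
Qed.

Lemma euler_dvdp a : Q %| a ^+ E - (qr_symbol a Q)%:~R.
Proof.
have [K [red [_ red0 euler]]] := qr_residue.
by rewrite -red0 rmorphB rmorphXn euler rmorph_int subrr.
Qed.

Lemma qrM a b : qr_symbol (a * b) Q = qr_symbol a Q * qr_symbol b Q.
Proof.
have [K [red [n2 red0 euler]]] := qr_residue.
apply: (sign_values_inj n2); rewrite ?sign_valuesM ?qr_sign_values //.
by rewrite intrM -!euler rmorphM exprMn.
Qed.

Lemma qr1 : qr_symbol 1 Q = 1.
Proof.
have [K [red [n2 red0 euler]]] := qr_residue.
by apply: (sign_values_inj n2); rewrite ?qr_sign_values // -euler rmorph1 expr1n.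
Qed.

Lemma qr_mod a b : Q %| a - b -> qr_symbol a Q = qr_symbol b Q.
Proof.
have [K [red [n2 red0 euler]]] := qr_residue.
rewrite -red0 rmorphB subr_eq0 => /eqP Dab.
by apply: (sign_values_inj n2); rewrite ?qr_sign_values // -!euler Dab.
Qed.

Lemma qrX a k : qr_symbol (a ^+ k) Q = qr_symbol a Q ^+ k.
Proof. by elim: k => [|k IH]; rewrite ?qr1 // !exprS qrM IH. Qed.

Lemma qr_prod (I : Type) (r : seq I) (p : pred I) (G : I -> {poly F}) :
  qr_symbol (\prod_(i <- r | p i) G i) Q = \prod_(i <- r | p i) qr_symbol (G i) Q.
Proof. exact: (big_morph (fun a => qr_symbol a Q) qrM qr1). Qed.

Lemma qr_eq0 a : (qr_symbol a Q == 0) = (Q %| a).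
Proof. by rewrite /qr_symbol; case: ifP => //; case: ifP. Qed.

Lemma qr_sqr a : ~~ (Q %| a) -> qr_symbol a Q ^+ 2 = 1.
Proof.
rewrite -qr_eq0; have := qr_sign_values a Q.
by rewrite !inE => /or3P[] /eqP->.
Qed.

Section Extension.
Variable L : fieldExtType F.
Local Notation "f ^L" := (map_poly (in_alg L) f) (at level 2, format "f ^L").

Lemma hornerL_frobenius f (x : L) i : f^L.[x ^+ (q ^ i)] = f^L.[x] ^+ (q ^ i).
Proof.
rewrite -horner_exp -rmorphXn /= exp_card_comp map_comp_poly map_polyXn.
by rewrite horner_comp hornerXn.
Qed.

Variable x : L.
Hypothesis Qx : root Q^L x.

Lemma dvdp_common_root f : f^L.[x] = 0 -> Q %| f.
Proof.
move=> fx; apply: contraT => nd.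
have : coprimep Q f by rewrite (irreducible_poly_coprime _ Q_mi.1).
rewrite -(coprimep_map (in_alg L)) => /coprimep_root /(_ Qx).
by rewrite fx eqxx.
Qed.

(** The conjugates [x ^+ (q ^ i)] are roots, and there are [deg Q] of them. If two agreed, undoing
    the smaller Frobenius power would give [Q %| 'X^(q ^ (j - i)) - 'X] with [0 < j - i < deg Q]. *)
Lemma irreducible_roots : Q^L = \prod_(i < (size Q).-1) ('X - (x ^+ (q ^ i))%:P).
Proof.
set d := (size Q).-1; pose rs := [seq x ^+ (q ^ i) | i <- iota 0 d].
have szQ : size Q = d.+1 by rewrite /d prednK //; have [[]] := Q_mi; case: (size Q).
have un : uniq rs.
  rewrite map_inj_in_uniq ?iota_uniq // => i j.
  rewrite !mem_iota !add0n /= => i_d j_d Dx.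
  wlog le_ij : i j i_d j_d Dx / (i <= j)%N.
    by move=> H; case: (leqP i j) => [|/ltnW] le; [|symmetry]; apply: H.
  apply/eqP; rewrite eqn_leq le_ij leqNgt; apply/negP => lt_ij.
  have : Q %| ('X^(q ^ (j - i)) - 'X) ^+ (q ^ i).
    apply: dvdp_common_root; rewrite rmorphXn rmorphB /= map_polyXn map_polyX.
    rewrite horner_exp !hornerE exprDn_pchar; last first.
      by apply: pchar_nat_card; apply: pchar_lalg.
    rewrite exprNn -signr_odd oddX q_odd orbT expr1 mulN1r.
    by rewrite -exprM -expnD subnK // Dx subrr.
  have Q_irr := Q_mi.1.
  move=> dv.
  have : Q %| 'X^(q ^ (j - i)) - 'X.
    apply: contraLR dv => nd.
    rewrite -irreducible_poly_coprime // coprimep_expr //.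
    by rewrite irreducible_poly_coprime.
  move/(dvdp_frobenius_leq Q_mi); rewrite subn_gt0 => /(_ lt_ij).
  by rewrite -/d; lia.
have rt : all (root Q^L) rs.
  apply/allP => _ /mapP[i _ ->].
  by rewrite rootE hornerL_frobenius (rootP Qx) expr0n expn_eq0 eqn0Ngt ltnW ?finNzRing_gt1.
rewrite [LHS](all_roots_prod_XsubC (rs := rs)) ?uniq_rootsE //.
  rewrite lead_coef_map (monicP Q_mi.2) rmorph1 scale1r.
  by rewrite big_map -(big_mkord xpredT (fun i => 'X - (x ^+ (q ^ i))%:P)) /index_iota subn0.
by rewrite size_map_poly szQ size_map size_iota.
Qed.

End Extension.
End Modulus.

Lemma geometric_exponent d : (\sum_(i < d) q ^ i * (q.-1)./2 = ((q ^ d).-1)./2)%N.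
Proof.
have q1 : q.-1 = ((q.-1)./2).*2.
  by rewrite -[LHS]odd_double_half; case: #|F| q_odd => //= n /negbTE ->.
by rewrite predn_exp -big_distrl /= [in RHS]q1 -doubleMl doubleK mulnC.
Qed.

(** Euler's criterion evaluated at the root [x]: the exponent [(q^d - 1)/2] splits by
    [geometric_exponent], and each power [q ^ i] moves onto the argument. *)
Lemma qr_horner (P Q : {poly F}) (L : fieldExtType F) (x : L) :
  monic_irreducible_poly Q -> root (map_poly (in_alg L) Q) x ->
  (qr_symbol P Q)%:~R =
  \prod_(i < (size Q).-1) (map_poly (in_alg L) P).[x ^+ (q ^ i)] ^+ (q.-1)./2.
Proof.
move=> Q_mi Qx; rewrite -[RHS]/(\prod_(i < _) _).
have /dvdpP[c] := euler_dvdp Q_mi P.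
move/(congr1 (fun f => (map_poly (in_alg L) f).[x])).
rewrite rmorphM rmorphB rmorphXn rmorph_int /= hornerM (rootP Qx) mulr0.
rewrite hornerD hornerN horner_exp -(rmorph_int polyC) hornerC => /eqP.
rewrite subr_eq0 => /eqP <-; rewrite -geometric_exponent -prodrXr.
by apply: eq_bigr => i _; rewrite hornerL_frobenius exprM.
Qed.

(** In a common splitting field both symbols are products, over all pairs of a root of [P] and a
    root of [Q], of the difference to the power [(q - 1)/2]. That exponent is even, so the order of
    subtraction is irrelevant. *)
Lemma qr_reciprocity (P Q : {poly F}) : (q %% 4 = 1)%N ->
  monic_irreducible_poly P -> monic_irreducible_poly Q ->
  qr_symbol P Q = qr_symbol Q P.
Proof.
move=> q4 P_mi Q_mi.
have nzPQ : P * Q != 0 by rewrite mulf_neq0 ?(irredp_neq0 P_mi.1) ?(irredp_neq0 Q_mi.1).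
have [L [rs]] := FinSplittingFieldFor nzPQ.
rewrite rmorphM => Drs _.
have ex_root f : monic_irreducible_poly f ->
    map_poly (in_alg L) f %| map_poly (in_alg L) P * map_poly (in_alg L) Q ->
    exists x, root (map_poly (in_alg L) f) x.
  move=> f_mi; rewrite (eqp_dvdr _ Drs) => /dvdp_prod_XsubC[m Df].
  have := eqp_size Df; rewrite size_prod_XsubC size_map_poly.
  case Dm: (mask m rs) => [|z zs] sz; last first.
    by exists z; rewrite (eqp_root Df) Dm root_prod_XsubC mem_head.
  by have [[]] := f_mi; rewrite sz.
have [x Px] := ex_root P P_mi (dvdp_mulr _ (dvdpp _)).
have [y Qy] := ex_root Q Q_mi (dvdp_mull _ (dvdpp _)).
have n2 : 2%:R != 0 :> L.
  by rewrite -[2%:R]scaler_nat scaler_eq0 oner_eq0 orbF two_neq0.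
apply: (sign_values_inj n2); rewrite ?qr_sign_values //.
rewrite (qr_horner P Q_mi Qy) (qr_horner Q P_mi Px).
rewrite (irreducible_roots P_mi Px) (irreducible_roots Q_mi Qy).
under eq_bigr do rewrite horner_prod -prodrXl.
under [RHS]eq_bigr do rewrite horner_prod -prodrXl.
rewrite exchange_big /=; apply: eq_bigr => i _; apply: eq_bigr => j _.
have even_h : odd (q.-1)./2 = false by lia.
by rewrite !hornerXsubC -opprB exprNn -signr_odd even_h mul1r.
Qed.

(** * Factorization into monic irreducibles *)

Lemma coprimep_big_prod (I : eqType) (r : seq I) (p : pred I) (G : I -> {poly F}) a :
  (forall i, i \in r -> p i -> coprimep a (G i)) ->
  coprimep a (\prod_(i <- r | p i) G i).
Proof.
elim: r => [|i r IH] cop; first by rewrite big_nil coprimep1.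
rewrite big_cons; have {}IH : coprimep a (\prod_(j <- r | p j) G j).
  by apply: IH => j jr; apply: cop; rewrite inE jr orbT.
by case: ifP => // pi; rewrite coprimepMr IH andbT cop ?mem_head.
Qed.

Lemma dvdp_big_prod (I : eqType) (r : seq I) (p : pred I) (G : I -> {poly F}) a :
  uniq r -> (forall i, i \in r -> p i -> G i %| a) ->
  (forall i j, p i -> p j -> i != j -> coprimep (G i) (G j)) ->
  \prod_(i <- r | p i) G i %| a.
Proof.
move=> un dv cop; elim: r un dv => [|i r IH] /=; first by rewrite big_nil dvd1p.
case/andP=> nir un dv; rewrite big_cons.
have {}IH : \prod_(j <- r | p j) G j %| a.
  by apply: IH => // j jr; apply: dv; rewrite inE jr orbT.
case: ifP => // pi; rewrite Gauss_dvdp ?dv ?mem_head //.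
apply: coprimep_big_prod => j jr pj; apply: cop => //.
by apply: contraNneq nir => ->.
Qed.

Lemma monic_irreducible_coprimep P Q : monic_irreducible_poly P -> monic_irreducible_poly Q ->
  P != Q -> coprimep P Q.
Proof.
move=> P_mi Q_mi; apply: contraNT; rewrite (irreducible_poly_coprime _ P_mi.1) negbK => dv.
rewrite -eqp_monic ?P_mi.2 ?Q_mi.2 //; apply: Q_mi.1.2 => //.
by have [[]] := P_mi; case: (size P) => [|[]].
Qed.

(** A nonconstant divisor of least size, made monic. *)
Lemma exists_irreducible_factor f : (1 < size f)%N -> exists2 Q, monic_irreducible_poly Q & Q %| f.
Proof.
move=> f_gt1; pose p n := [exists Q : {poly_n F}, (val Q %| f) && (size (val Q) == n) && (1 < n)%N].
have ex : exists n, p n.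
  exists (size f); apply/existsP; exists (npolyp _ f).
  by rewrite /= npolypK // dvdpp eqxx.
case: (ex_minnP ex) => n /existsP[[Q /= _] /andP[/andP[Qf /eqP sQ] n_gt1]] min.
have Q0 : Q != 0 by rewrite -size_poly_gt0 sQ ltnW.
have lc0 : lead_coef Q != 0 by rewrite lead_coef_eq0.
exists ((lead_coef Q)^-1 *: Q); last by rewrite dvdpZl ?invr_eq0.
split; last by rewrite monicE lead_coefZ mulVf.
split; first by rewrite size_scale ?invr_eq0 // sQ.
move=> a a1; rewrite dvdpZr ?invr_eq0 // => aQ.
suff aQ_eqp : a %= Q by apply: eqp_trans aQ_eqp _; rewrite eqp_sym eqp_scale ?invr_eq0.
rewrite -dvdp_size_eqp //.
rewrite eqn_leq dvdp_leq // sQ min //; apply/existsP; exists (npolyp _ a).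
rewrite /= npolypK // (dvdp_trans aQ) // eqxx /=.
have : size a != 0 by rewrite size_poly_eq0; apply: contraNneq Q0 => a0; rewrite a0 dvd0p in aQ.
by case: (size a) a1 => [|[]].
Qed.

Section Multiplicity.
Variables (Q f : {poly F}).
Hypotheses (Q_mi : monic_irreducible_poly Q) (f0 : f != 0).

Lemma dvdp_multiplicity : Q ^+ (multiplicity Q f) %| f.
Proof.
rewrite /multiplicity.
have : (0 < #|'I_(size f)|)%N by rewrite card_ord size_poly_gt0.
case/(bigop.eq_bigmax (fun e : 'I_(size f) => if Q ^+ e %| f then (e : nat) else 0%N)) => e ->.
by case: ifP => // _; rewrite expr0 dvd1p.
Qed.

Lemma multiplicity_max e : Q ^+ e %| f -> (e <= multiplicity Q f)%N.
Proof.
move=> dv; have e_lt : (e < size f)%N.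
  apply: leq_trans (dvdp_leq f0 dv).
  rewrite (polySpred (expf_neq0 e (irredp_neq0 Q_mi.1))) size_exp ltnS leq_pmull //.
  by have [[]] := Q_mi; case: (size Q) => [|[]].
rewrite /multiplicity.
have := leq_bigmax (F := fun e : 'I_(size f) => if Q ^+ e %| f then (e : nat) else 0%N)
  (Ordinal e_lt).
by rewrite /= dv.
Qed.
End Multiplicity.

Definition monic_irreducible (P : {poly F}) := (P \is monic) && irreducibleb P.

Lemma monic_irreducibleP P : monic_irreducible P -> monic_irreducible_poly P.
Proof. by case/andP => m /irreducibleP. Qed.

Lemma monic_irreducibleI P : monic_irreducible_poly P -> monic_irreducible P.
Proof. by case=> i m; rewrite /monic_irreducible m; apply/irreducibleP. Qed.

(** The product divides [f] by coprimality of its factors. An irreducible factor of the cofactor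
    would raise a multiplicity above its maximum, so the cofactor is 1. The index set is that of
    [jacobi]. *)
Lemma monic_factorization f : f \is monic ->
  f = \prod_(Q : {poly_(size f) F} | monic_irreducible (val Q)) val Q ^+ multiplicity (val Q) f.
Proof.
move=> f_mon; have f0 := monic_neq0 f_mon; set g := (RHS).
have g_mon : g \is monic.
  by apply: monic_prod => Q /monic_irreducibleP[_ Q_mon]; rewrite monic_exp.
have : g %| f.
  apply: dvdp_big_prod => [|Q _ /monic_irreducibleP Q_mi|Q R /monic_irreducibleP Q_mi /monic_irreducibleP R_mi neq].
  - exact: index_enum_uniq.
  - exact: dvdp_multiplicity.
  by apply/coprimep_expl/coprimep_expr/monic_irreducible_coprimep.
case/dvdpP=> h Df; have h_mon : h \is monic by rewrite -(monicMr _ g_mon) -Df.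
have [h1|/exists_irreducible_factor[Q Q_mi Qh]] := leqP (size h) 1.
  rewrite Df (_ : h = 1) ?mul1r //.
  by move: h_mon; rewrite (size1_polyC h1) monicE lead_coefC => /eqP->.
have Qf : Q %| f by rewrite Df dvdp_mulr.
have sQ : (size Q <= size f)%N by apply: dvdp_leq.
have : Q ^+ (multiplicity Q f).+1 %| f.
  rewrite exprS [X in _ %| X]Df dvdp_mul // /g (bigD1 (npolyp (size f) Q)) /= ?npolypK ?monic_irreducibleI //.
  exact: dvdp_mulr.
by move/(multiplicity_max Q_mi f0); rewrite ltnn.
Qed.

Lemma chi_qr P f : (q %% 4 = 1)%N -> monic_irreducible_poly P -> f \is monic ->
  chi P f = qr_symbol f P.
Proof.
move=> q4 P_mi f_mon; rewrite {2}(monic_factorization f_mon) (qr_prod P_mi).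
apply: eq_bigr => Q /monic_irreducibleP Q_mi; rewrite (qrX P_mi).
by rewrite (qr_reciprocity q4).
Qed.

End QuadraticSymbol.

(** * The functional equation *)

Section FunctionalEquation.
Variable F : finFieldType.
Local Notation q := #|F|.
Hypothesis q_odd : odd q.
Let q_gt1 : (1 < q)%N. Proof. exact: finNzRing_gt1. Qed.

(** Parametrizing monic polynomials by their lower part turns sums over them into sums over a vector
    space, where translations and linear forms are available. *)
Definition monic_of n (v : {poly F}) : {poly F} := 'X^n + v.

Lemma size_monic_of n (v : {poly_n F}) : size (monic_of n (val v)) = n.+1.
Proof. by rewrite size_polyDl size_polyXn // ltnS size_npoly. Qed.

Lemma monic_monic_of n (v : {poly_n F}) : monic_of n (val v) \is monic.
Proof.
rewrite monicE lead_coefE size_monic_of coefD coefXn eqxx.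
by rewrite (nth_default 0 (size_npoly v)) addr0.
Qed.

Lemma size_sub_monic n (f : {poly F}) :
  f \is monic -> size f = n.+1 -> (size (f - 'X^n)%R <= n)%N.
Proof.
move=> /monicP lc sf; apply/leq_sizeP => j le_nj; rewrite coefB coefXn.
case: eqP => [->|/eqP ne]; first by rewrite -[n]/(n.+1.-1) -sf -lead_coefE lc subrr.
by rewrite nth_default ?subrr // sf ltn_neqAle eq_sym ne.
Qed.

Lemma big_monic (R : zmodType) n (G : {poly F} -> R) :
  \sum_(f : {poly_(n.+1) F} | (val f \is monic) && (size (val f) == n.+1)) G (val f) =
  \sum_(v : {poly_n F}) G (monic_of n (val v)).
Proof.
have valE (v : {poly_n F}) : val (npolyp n.+1 (monic_of n (val v))) = monic_of n (val v).
  by rewrite /= npolypK // size_monic_of.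
rewrite (reindex_onto (fun v : {poly_n F} => npolyp n.+1 (monic_of n (val v)))
  (fun f => npolyp n (val f - 'X^n))) /=; last first.
  move=> f /andP[f_mon /eqP sf]; apply: val_inj; rewrite /= npolypK.
    by rewrite npolypK ?size_sub_monic // /monic_of addrC subrK.
  by rewrite npolypK ?size_sub_monic // /monic_of addrC subrK sf.
apply: eq_big => [v|v _]; last by rewrite valE.
rewrite valE monic_monic_of size_monic_of eqxx /=.
by apply/eqP/val_inj; rewrite /= /monic_of addrC addKr npolypK ?size_npoly.
Qed.

Variables (P : {poly F}) (g : nat).
Hypotheses (P_mi : monic_irreducible_poly P) (sP : size P = (2 * g + 1).+1).
Local Notation N := (2 * g + 1)%N.
Local Notation chi f := (qr_symbol f P).
Local Notation qc c := (qr_symbol c%:P P).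

Lemma small_ndvdp (f : {poly F}) : f != 0 -> (size f <= N)%N -> ~~ (P %| f).
Proof. by move=> f0 sf; apply: contraTN sf => /(dvdp_leq f0); rewrite sP -ltnNge. Qed.

(* A nonresidue of [F] stays one modulo [P] because [deg P] is odd. *)
Lemma const_nonresidue : exists2 c : F, c != 0 & qc c = -1.
Proof.
have [c c0 hc] : exists2 c : F, c != 0 & c ^+ (q.-1)./2 = -1.
  have [c c0 hc] : exists2 c : F, c != 0 & c ^+ (q.-1)./2 != 1.
    apply/exists_inP; apply: contraT; rewrite negb_exists_in => /forall_inP all1.
    have nz : 'X^((q.-1)./2) - 1 != 0 :> {poly F}.
      by rewrite -size_poly_gt0 size_XnsubC //; lia.
    have rt : all (root ('X^((q.-1)./2) - 1)) (enum (predC1 (0 : F))).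
      apply/allP => x; rewrite mem_enum => /all1; rewrite negbK => /eqP h.
      by rewrite rootE !hornerE h subrr.
    have := max_poly_roots nz rt (enum_uniq _).
    rewrite -cardE cardC1 size_XnsubC; last by lia.
    by rewrite -[#|_|]/q; lia.
  exists c => //; apply/eqP; have : (c ^+ (q.-1)./2) ^+ 2 == 1.
    rewrite -exprM; have -> : ((q.-1)./2 * 2 = q.-1)%N by lia.
    by rewrite -(inj_eq (mulfI c0)) -exprS prednK ?expf_card ?mulr1 // ltnW.
  by rewrite sqrf_eq1 (negbTE hc).
exists c => //.
have [K [red [n2 red0 euler]]] := qr_residue q_odd P_mi.
apply: (sign_values_inj n2); rewrite ?qr_sign_values //.
rewrite -euler sP -[_.+1.-1]/N -(geometric_exponent q_odd) -big_distrl /= [X in _ ^+ X]mulnC exprM.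
rewrite -!rmorphXn /= hc -signr_odd.
(* Euler's exponent is [(q - 1)/2] times a sum of [N] odd terms, with [N] odd. *)
have -> : odd (\sum_(i < N) q ^ i) = odd N.
  elim: N => [|k IH]; first by rewrite big_ord0.
  by rewrite big_ord_recr /= oddD IH oddX q_odd orbT addbT.
by rewrite oddD mul2n odd_double /= expr1 !rmorphN !rmorph1.
Qed.

Lemma qcM (c d : F) : qc (c * d) = qc c * qc d.
Proof. by rewrite polyCM qrM. Qed.

Lemma qc0 : qc 0 = 0.
Proof. by apply/eqP; rewrite qr_eq0 dvdp0. Qed.

Lemma qc_sqr (c : F) : c != 0 -> qc c ^+ 2 = 1.
Proof.
move=> c0; apply: qr_sqr; apply: small_ndvdp; rewrite ?polyC_eq0 //.
by rewrite size_polyC c0; lia.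
Qed.

Lemma sum_qc : \sum_(c : F) qc c = 0.
Proof.
have [c0 nz hc] := const_nonresidue.
suff : \sum_(c : F) qc c = - \sum_(c : F) qc c by lia.
rewrite {1}(reindex_inj (mulfI nz)) -sumrN; apply: eq_bigr => c _.
by rewrite qcM hc mulN1r.
Qed.

(** A nonzero linear form on residues modulo [P]. Composed with the quadratic character of [F], it
    stands in for the additive character of a classical Gauss sum. *)
Definition top_coef (f : {poly F}) : F := (f %% P)`_(2 * g).

Lemma top_coefD (a b : {poly F}) : top_coef (a + b) = top_coef a + top_coef b.
Proof. by rewrite /top_coef modpD coefD. Qed.

Lemma top_coefZ (c : F) (a : {poly F}) : top_coef (c *: a) = c * top_coef a.
Proof. by rewrite /top_coef modpZl coefZ. Qed.

Lemma top_coef_small (a : {poly F}) : (size a <= N)%N -> top_coef a = a`_(2 * g).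
Proof. by move=> sa; rewrite /top_coef modp_small // sP. Qed.

(** The constant [tau] of the functional equation. On reduced residues [top_coef] is a plain
    coefficient. *)
Definition gauss_sum : int := \sum_(h : {poly_N F}) chi (val h) * qc ((val h)`_(2 * g)).

(** Multiplication by [f] permutes the residues, and [chi f] is its own inverse. *)
Lemma gauss_sum_twist (f : {poly F}) : ~~ (P %| f) ->
  \sum_(h : {poly_N F}) chi (val h) * qc (top_coef (f * val h)) = chi f * gauss_sum.
Proof.
move=> nd; have smod a : (size (a %% P)%R <= N)%N by rewrite -ltnS -sP ltn_modp (irredp_neq0 P_mi.1).
pose mulf (h : {poly_N F}) : {poly_N F} := npolyp N ((f * val h) %% P).
have mulf_inj : injective mulf.
  move=> h k /(congr1 val); rewrite /= !npolypK // => /eqP.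
  rewrite -subr_eq0 -modpN -modpD -mulrBr => dv; apply/val_inj/eqP.
  rewrite -subr_eq0; apply: contraLR nd => nz.
  have cop : coprimep P (val h - val k).
    rewrite (irreducible_poly_coprime _ P_mi.1) small_ndvdp //.
    by rewrite (leq_trans (size_polyD _ _)) // size_polyN geq_max !size_npoly.
  by rewrite negbK -(Gauss_dvdpl _ cop).
rewrite /gauss_sum [in RHS](reindex_inj mulf_inj) mulr_sumr; apply: eq_bigr => h _.
rewrite /= npolypK // mulrA; congr (_ * _).
have -> : chi ((f * val h) %% P) = chi (f * val h).
  apply/esym; apply: qr_mod => //; rewrite {1}(divp_eq (f * val h) P) addrK.
  exact: dvdp_mull.
by rewrite qrM // mulrA -expr2 qr_sqr // mul1r.
Qed.

(** A nonzero linear form can absorb any shift [a], so the sum equals its average over [a], which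
    vanishes by [sum_qc]. *)
Lemma affine_sum n (c : F) (ell : {poly_n F} -> F) :
  (forall v w, ell (v + w) = ell v + ell w) ->
  (forall a v, ell (a *: v) = a * ell v) -> (exists v, ell v != 0) ->
  \sum_(v : {poly_n F}) qc (c + ell v) = 0.
Proof.
move=> ellD ellZ [w w0]; set S := LHS.
have shift a : S = \sum_(v : {poly_n F}) qc (c + ell v + a).
  rewrite /S (reindex_inj (addIr ((a / ell w) *: w))); apply: eq_bigr => v _.
  by rewrite ellD ellZ divfK // addrA.
have : S *+ q = 0.
  have -> : S *+ q = \sum_(a : F) S by rewrite sumr_const.
  rewrite (eq_bigr _ (fun a _ => shift a)) exchange_big /=.
  rewrite big1 // => v _; rewrite -{2}sum_qc.
  by rewrite [RHS](reindex_inj (addrI (c + ell v))).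
move/eqP; rewrite -mulr_natr mulf_eq0 => /orP[/eqP//|].
by rewrite Num.Theory.pnatr_eq0 eqn0Ngt ltnW.
Qed.

Definition monic_sum n : int := \sum_(v : {poly_n F}) chi (monic_of n (val v)).

(** For short [h] the product is not reduced modulo [P], and its top coefficient does not depend on
    [v]. For longer [h] it varies with [v] through a nonzero linear form, and [affine_sum]
    applies. *)
Lemma monic_sum_dual_inner n (h : {poly F}) : (n < N)%N -> (size h <= N)%N ->
  \sum_(v : {poly_n F}) chi h * qc (top_coef (monic_of n (val v) * h)) =
  (if (size h <= N - n)%N then (chi h * qc h`_(2 * g - n)) *+ (q ^ n) else 0).
Proof.
move=> nN sN; case: leqP => sh.
  rewrite -(card_npoly F n) -sumr_const; apply: eq_bigr => v _; congr (_ * qc _).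
  have bound a b : (a <= n -> b <= N - n -> (a + b).-1 <= 2 * g)%N by lia.
  rewrite top_coef_small; last first.
    rewrite (leq_trans (size_polyMleq _ _)) // size_monic_of; lia.
  rewrite /monic_of mulrDl coefD coefXnM ifN; last by rewrite -leqNgt; lia.
  rewrite [X in _ + X]nth_default ?addr0 // (leq_trans (size_polyMleq _ _)) //.
  exact: bound (size_npoly v) sh.
rewrite -mulr_sumr.
under eq_bigr do rewrite mulrDl top_coefD.
rewrite (@affine_sum n _ (fun v => top_coef (val v * h))) ?mulr0 //.
- by move=> v w; rewrite /= mulrDl top_coefD.
- by move=> a v; rewrite /= -scalerAl top_coefZ.
have bnd : (N - size h < n)%N by lia.
(* This monomial moves the leading coefficient of [h] to position [2 * g]. *)
exists (npolyp n 'X^(N - size h)); rewrite /= npolypK ?size_polyXn; last by exact: bnd.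
have h0 : h != 0 by rewrite -size_poly_gt0; lia.
rewrite top_coef_small; last first.
  by rewrite mulrC size_mulXn // addnC subnKC.
have bnd2 : (N - size h <= 2 * g)%N by lia.
rewrite coefXnM ifN; last by rewrite -leqNgt.
have -> : (2 * g - (N - size h) = (size h).-1)%N by lia.
by rewrite -lead_coefE lead_coef_eq0.
Qed.

(** Only [h] of degree exactly [m] contribute. Writing [h] as a scalar [c] times a monic polynomial,
    [qc c] occurs twice and cancels, so each of the [q - 1] scalars gives [monic_sum m]. *)
Lemma sum_scaled_monic m : (m < N)%N ->
  \sum_(h : {poly_N F} | (size (val h) <= m.+1)%N) chi (val h) * qc ((val h)`_m) =
  monic_sum m *+ q.-1.
Proof.
move=> mN; rewrite (bigID (fun h : {poly_N F} => (val h)`_m == 0)) /= big1 ?add0r; last first.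
  by move=> h /andP[_ /eqP->]; rewrite qc0 mulr0.
have valE (cv : F * {poly_m F}) :
    val (npolyp N (cv.1 *: monic_of m (val cv.2))) = cv.1 *: monic_of m (val cv.2).
  rewrite /= npolypK //; case: (eqVneq cv.1 0) => [->|nz]; first by rewrite scale0r size_poly0.
  by rewrite size_scale // size_monic_of.
have coefE (v : {poly_m F}) : (monic_of m (val v))`_m = 1.
  by have /monicP := monic_monic_of v; rewrite lead_coefE size_monic_of.
rewrite (reindex_onto (fun cv : F * {poly_m F} => npolyp N (cv.1 *: monic_of m (val cv.2)))
  (fun h => ((val h)`_m, npolyp m (((val h)`_m)^-1 *: val h - 'X^m)))) /=; last first.
  move=> h /andP[sh hm]; apply: val_inj.
  have sub : (size (((val h)`_m)^-1 *: val h - 'X^m)%R <= m)%N.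
    have sh' : size (val h) = m.+1.
      by apply/eqP; rewrite eqn_leq sh ltnNge; apply: contraNN hm => /(nth_default 0)->.
    apply: size_sub_monic; last by rewrite size_scale ?invr_eq0.
    by rewrite monicE lead_coefZ lead_coefE sh' mulVf.
  rewrite [LHS](valE ((val h)`_m, npolyp m (((val h)`_m)^-1 *: val h - 'X^m))) /=.
  rewrite npolypK // /monic_of addrC subrK scalerA mulfV ?scale1r //.
rewrite (eq_bigl (fun cv : F * {poly_m F} => (cv.1 != 0) && true)); last first.
  move=> [c v] /=; have := valE (c, v); rewrite /= => ->.
  rewrite coefZ coefE mulr1 andbT; case: (eqVneq c 0) => [->|c0]; first by rewrite andbF.
  rewrite size_scale // size_monic_of leqnn /= xpair_eqE eqxx /=.
  apply/eqP/val_inj; rewrite /= scalerA mulVf // scale1r /monic_of addrC addKr.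
  by rewrite npolypK ?size_npoly.
rewrite -(pair_big (fun c => c != 0) (fun _ => true) (fun c v =>
  let h := npolyp N (c *: monic_of m (val v)) in chi (val h) * qc (val h)`_m)) /=.
rewrite -(cardC1 (0 : F)) -sumr_const; apply: eq_bigr => c c0.
apply: eq_bigr => v _; have := valE (c, v); rewrite /= => ->.
rewrite coefZ coefE mulr1 -mul_polyC qrM // mulrAC -expr2 qc_sqr // mul1r //.
Qed.

(** The double sum over monic [f] and residues [h] is evaluated in both orders: over [h] first by
    [gauss_sum_twist], over [f] first by [monic_sum_dual_inner]. *)
Lemma gauss_monic_sum n : (n < N)%N ->
  gauss_sum * monic_sum n = (monic_sum (2 * g - n) *+ q.-1) *+ q ^ n.
Proof.
move=> nN; rewrite mulrC [monic_sum n]/monic_sum mulr_suml.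
under eq_bigr => v _ do
  rewrite -gauss_sum_twist ?small_ndvdp ?monic_neq0 ?monic_monic_of ?size_monic_of //.
rewrite exchange_big /=.
under eq_bigr => h _ do rewrite monic_sum_dual_inner ?size_npoly //.
have mN : (2 * g - n < N)%N by lia.
rewrite -big_mkcond sumrMnl -(sum_scaled_monic mN); congr (_ *+ _).
by apply: eq_bigl => h; congr (_ <= _)%N; lia.
Qed.

(** A sum of [q ^ g] signs has the parity of [q ^ g], which is odd; [s] counts the negative ones. *)
Lemma monic_sum_center_neq0 : monic_sum g != 0.
Proof.
have [s ->] : exists s : nat, monic_sum g = (q ^ g)%:Z - (2 * s)%:Z.
  exists (\sum_(v : {poly_g F}) nat_of_bool (chi (monic_of g (val v)) == -1)%R)%N.
  rewrite -(card_npoly F g) -sum1_card big_distrr /=.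
  rewrite !(big_morph Posz PoszD (erefl _)) -sumrB; apply: eq_bigr => v _.
  have : chi (monic_of g (val v)) != 0.
    by rewrite qr_eq0 small_ndvdp ?monic_neq0 ?monic_monic_of ?size_monic_of //; lia.
  have := qr_sign_values (monic_of g (val v)) P.
  by rewrite !inE => /or3P[] /eqP->.
have : odd (q ^ g) by rewrite oddX q_odd orbT.
by lia.
Qed.

Lemma monic_sum_functional_equation n : (n < N)%N ->
  monic_sum n *+ q ^ g = monic_sum (2 * g - n) *+ q ^ n.
Proof.
have tau : gauss_sum = (q.-1 * q ^ g)%:Z.
  have gN : (g < N)%N by lia.
  have := gauss_monic_sum gN; rewrite (_ : (2 * g - g = g)%N); last by lia.
  rewrite -mulrnA -mulr_natr mulrC => /(mulfI monic_sum_center_neq0) ->.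
  by rewrite natz.
move=> nN; have := gauss_monic_sum nN; rewrite tau.
rewrite -(mulr_natr _ (q ^ n)) -(mulr_natr _ q.-1) -natz natrM => H.
have q1 : q.-1%:R != 0 :> int by rewrite Num.Theory.pnatr_eq0; lia.
rewrite -(mulr_natr (monic_sum n)) -(mulr_natr (monic_sum (2 * g - n))).
by apply: (mulfI q1); rewrite [monic_sum n * _]mulrC mulrA H -!mulrA mulrCA.
Qed.

End FunctionalEquation.

(** * Stepanov's method *)

Section CoefficientDegree.
Variable R : idomainType.
Implicit Types (p r : {poly {poly R}}).

(** The outer variable is a second variable Y, later specialized to [W] or ['X^Q]; this bounds the
    degree in the inner variable X only. *)
Definition coef_deg_le (d : nat) p := forall i : nat, (size (p`_i)%R <= d.+1)%N.

Lemma coef_deg_leW d e p : (d <= e)%N -> coef_deg_le d p -> coef_deg_le e p.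
Proof. by move=> le dp i; apply: leq_trans (dp i) _; rewrite ltnS. Qed.

Lemma coef_deg_leD d p r : coef_deg_le d p -> coef_deg_le d r -> coef_deg_le d (p + r).
Proof.
by move=> dp dr i; rewrite coefD (leq_trans (size_polyD _ _)) // geq_max dp dr.
Qed.

Lemma coef_deg_leN d p : coef_deg_le d p -> coef_deg_le d (- p).
Proof. by move=> dp i; rewrite coefN size_polyN. Qed.

Lemma coef_deg_le_sum (I : Type) (s : seq I) (G : I -> {poly {poly R}}) d :
  (forall i, coef_deg_le d (G i)) -> coef_deg_le d (\sum_(i <- s) G i).
Proof.
move=> dG; elim/big_ind: _ => // [i|p r]; last exact: coef_deg_leD.
by rewrite coef0 size_poly0.
Qed.

Lemma coef_deg_leM d e p r :
  coef_deg_le d p -> coef_deg_le e r -> coef_deg_le (d + e) (p * r).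
Proof.
move=> dp er i; rewrite coefM (leq_trans (size_sum _ _ _)) //.
apply/bigmax_leqP => j _; rewrite (leq_trans (size_polyMleq _ _)) //.
by have := dp j; have := er (i - j)%N; lia.
Qed.

Lemma coef_deg_leC d (a : {poly R}) : (size a <= d.+1)%N -> coef_deg_le d a%:P.
Proof. by move=> sa i; rewrite coefC; case: eqP; rewrite ?size_poly0. Qed.

Lemma coef_deg_leX d p k : coef_deg_le d p -> coef_deg_le (k * d) (p ^+ k).
Proof.
move=> dp; elim: k => [|k IH]; first by apply: coef_deg_leC; rewrite size_poly1.
by rewrite exprS mulSn; apply: coef_deg_leM.
Qed.

Lemma coef_deg_leXY : coef_deg_le 1 ('X%:P + 'X : {poly {poly R}}).
Proof.
apply: coef_deg_leD; first by apply: coef_deg_leC; rewrite size_polyX.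
by move=> i; rewrite coefX; case: eqP; rewrite ?size_poly0 ?size_poly1.
Qed.

(** The coefficients are digits in base ['X^m]: being shorter than [m], they cannot overlap or
    cancel. *)
Lemma horner_polyXn_eq0 m p : (0 < m)%N ->
  (forall i, (size (p`_i)%R <= m)%N) -> p.['X^m] = 0 -> p = 0.
Proof.
move=> m_gt0; elim/poly_ind: p => // p c IH sz.
have sc : (size c <= m)%N by have := sz 0%N; rewrite coefD coefMX coefC /= add0r.
have sp i : (size (p`_i)%R <= m)%N by have := sz i.+1; rewrite coefD coefMX coefC /= addr0.
rewrite hornerMXaddC => H.
have p0 : p.['X^m] = 0.
  apply/eqP; apply: contraT => nz.
  have : (size (p.['X^m] * 'X^m)%R <= m)%N.
    by move/eqP: H; rewrite addr_eq0 => /eqP->; rewrite size_polyN.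
  by rewrite size_mulXn // -[X in (_ <= X)%N]addn0 leq_add2l leqn0 size_poly_eq0 (negbTE nz).
by move: H; rewrite (IH sp p0) horner0 !mul0r !add0r => ->.
Qed.

End CoefficientDegree.

Section Stepanov.
Variable F : finFieldType.
Local Notation q := #|F|.
Hypothesis q_odd : odd q.
Variables (f D : {poly F}) (k : nat) (eps : F).
Local Notation Q := (q ^ k)%N.
Local Notation E := (Q.-1)./2.
Local Notation W := ('X^Q - 'X : {poly F}).
Local Notation n := (size f).-1.
Hypotheses (k_gt0 : (0 < k)%N) (f_mon : f \is monic).
Hypothesis f_nsq : forall l : {poly F}, f <> l ^+ 2.
Hypotheses (eps_sqr : eps ^+ 2 = 1) (DW : D %| W) (Df : D %| f ^+ E - eps%:P).
Variables (J b M : nat).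
Hypotheses (bQ : (2 * b + n < Q)%N) (MQ : (M <= E)%N).
(* More free coefficients than linear conditions in the choice of the auxiliary
   polynomial. *)
Hypothesis count : (M.+1 * (M * n + b + J).+1 < 2 * (J.+1 * b.+1))%N.

Let q_gt1 : (1 < q)%N. Proof. exact: finNzRing_gt1. Qed.
Let Q_odd : odd Q. Proof. by rewrite oddX q_odd orbT. Qed.
Let QE : Q = (E * 2).+1.
Proof.
move: Q_odd; case: Q => // m /= /negbTE om.
by rewrite muln2 -[in LHS](odd_double_half m) om.
Qed.
Let f0 : f != 0. Proof. exact: monic_neq0. Qed.
Let epsP_sqr : (eps%:P : {poly F}) * eps%:P = 1. Proof. by rewrite -polyCM -expr2 eps_sqr. Qed.

Let XW : 'X + W = 'X^Q. Proof. by rewrite addrC subrK. Qed.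

Let E_gt0 : (0 < E)%N.
Proof.
suff : (2 < Q)%N by move: QE; lia.
have : (q <= Q)%N by rewrite -{1}(expn1 q) leq_exp2l.
have : (2 < q)%N by move: q_gt1 q_odd; case: #|F| => [|[|[|]]].
lia.
Qed.

(** A common divisor divides both [f ^+ E] and [f ^+ E - eps%:P], hence the unit [eps]. *)
Lemma coprime_Df : coprimep D f.
Proof.
apply/coprimepP => d dD df; rewrite -size_poly_eq1 -dvdp1 -epsP_sqr dvdp_mulr //.
rewrite -(subKr (f ^+ E) eps%:P); apply: dvdp_sub; last exact: dvdp_trans dD Df.
by rewrite -(prednK E_gt0) exprS dvdp_mulr.
Qed.

(** This is f(X + Y), Y being the outer variable. *)
Definition shifted : {poly {poly F}} :=
  \sum_(i < size f) (f`_i)%:P%:P * ('X%:P + 'X) ^+ i.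

Lemma shifted_horner (w : {poly F}) : shifted.[w] = f \Po ('X + w).
Proof.
rewrite comp_polyE horner_sum; apply: eq_bigr => i _.
by rewrite hornerM hornerC horner_exp hornerD hornerC hornerX mul_polyC.
Qed.

Lemma shifted_deg : coef_deg_le n shifted.
Proof.
apply: coef_deg_le_sum => i; apply: (@coef_deg_leW _ (0 + i * 1)).
  by have := ltn_ord i; lia.
apply: coef_deg_leM; first by apply: coef_deg_leC; rewrite size_polyC; case: eqP.
exact/coef_deg_leX/coef_deg_leXY.
Qed.

(* Truncation at order [M] of [f^M (1 + y)^(E+1)] where [y = f(X+Y)/f(X) - 1].
   At [Y = W] one has [1 + y = f^(Q-1)], so that the full series becomes
   [f^(M+E) f^(EQ)], which is [eps f^(M+E)] modulo [D^Q]. *)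
Definition root_series : {poly {poly F}} :=
  \sum_(l < M.+1) (f ^+ (M - l) *+ 'C(E.+1, l))%:P * (shifted - f%:P) ^+ l.

Lemma root_series_deg : coef_deg_le (M * n) root_series.
Proof.
apply: coef_deg_le_sum => l; apply: (@coef_deg_leW _ ((M - l) * n + l * n)).
  by rewrite -mulnDl subnK // -ltnS.
apply: coef_deg_leM.
  apply: coef_deg_leC; rewrite -mulr_natr -polyC_natr mulrC mul_polyC.
  rewrite (leq_trans (size_scale_leq _ _)) //.
  by rewrite (polySpred (expf_neq0 _ f0)) size_exp mulnC.
apply/coef_deg_leX/coef_deg_leD; first exact: shifted_deg.
by apply/coef_deg_leN/coef_deg_leC; rewrite -polySpred.
Qed.

(** Modulo [D], [f ^+ Q.-1] is the square of [eps], so [D] divides [y] and the truncated terms are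
    multiples of [D ^+ M.+1]. The untruncated series is exact up to [(f ^+ E - eps%:P) ^+ Q]. *)
Lemma root_series_horner :
  D ^+ M.+1 %| root_series.[W] - eps%:P * (f ^+ M * f ^+ E).
Proof.
pose y := f ^+ Q.-1 - 1.
have Dy : D %| y.
  rewrite /y QE /= exprM -(epsP_sqr) -expr2 subr_sqr.
  by rewrite dvdp_mulr.
have -> : root_series.[W] = f ^+ M * \sum_(l < M.+1) y ^+ l *+ 'C(E.+1, l).
  rewrite horner_sum mulr_sumr; apply: eq_bigr => l _.
  rewrite hornerM hornerC horner_exp hornerD hornerN hornerC shifted_horner.
  rewrite XW -exp_card_comp.
  have -> : f ^+ Q - f = f * y by rewrite /y mulrBr mulr1 -exprS prednK // QE.
  by rewrite exprMn mulrnAl mulrnAr mulrA -exprD subnK // -ltnS.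
have full : (1 + y) ^+ E.+1 = f ^+ (E * Q) * f ^+ E.
  rewrite /y addrC subrK -exprM -exprD; congr (_ ^+ _).
  suff exponents e m : m = (e * 2).+1 -> (m.-1 * e.+1 = e * m + e)%N by apply: exponents.
  by move=> ->; rewrite /=; ring.
rewrite mulrCA -mulrBr; apply: dvdp_mull.
have -> : \sum_(l < M.+1) y ^+ l *+ 'C(E.+1, l) =
    (1 + y) ^+ E.+1 - \sum_(M.+1 <= l < E.+2) y ^+ l *+ 'C(E.+1, l).
  rewrite exprDn -(big_mkord xpredT (fun l => y ^+ l *+ 'C(E.+1, l))).
  rewrite -(big_mkord xpredT (fun l => 1 ^+ (E.+1 - l) * y ^+ l *+ 'C(E.+1, l))).
  under [X in X - _]eq_bigr do rewrite expr1n mul1r.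
  by rewrite (@big_cat_nat _ _ _ M.+1 0 E.+2) //= ?addrK // ltnS leqW.
rewrite full addrAC -mulrBl dvdp_add //.
  apply: dvdp_mulr; apply: (dvdp_trans (dvdp_exp2l D _ : D ^+ M.+1 %| D ^+ Q)).
    by rewrite QE; lia.
  have -> : f ^+ (E * Q) - eps%:P = (f ^+ E - eps%:P) ^+ Q.
    rewrite exprDn_pchar ?pchar_nat_card //; last exact: pchar_poly.
    by rewrite exprNn -signr_odd Q_odd expr1 mulN1r -exprM -polyC_exp expf_card_iter.
  exact: dvdp_exp2r.
rewrite dvdpNr big_nat; elim/big_ind: _ => [|u v Du Dv|l /andP[Ml _]]; rewrite ?dvdp0 ?dvdp_add //.
rewrite -mulr_natr dvdp_mulr // (dvdp_trans (dvdp_exp2l D Ml)) //.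
exact: dvdp_exp2r.
Qed.

Section Auxiliary.
Variables (u v : 'I_J.+1 -> {poly F}).

(** Stepanov's auxiliary polynomial, with [J.+1] digits in base ['X^Q]; the unknowns [u] and [v]
    will have degree at most [b]. *)
Definition aux_poly : {poly F} :=
  \sum_(j < J.+1) (u j + v j * f ^+ E) * 'X^(Q * j).

Definition aux_series : {poly {poly F}} :=
  \sum_(j < J.+1) ((f ^+ M * u j)%:P + (eps%:P * v j)%:P * root_series) * ('X%:P + 'X) ^+ j.

(** At Y = [W] the factor X + Y becomes ['X^Q], and [root_series] supplies
    [eps%:P * f ^+ M * f ^+ E]; the two factors [eps] multiply to 1. *)
Lemma aux_series_horner : D ^+ M.+1 %| aux_series.[W] - f ^+ M * aux_poly.
Proof.
rewrite horner_sum mulr_sumr -sumrB.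
elim/big_ind: _ => [|x y Dx Dy|j _]; [exact: dvdp0 | exact: dvdp_add | ].
rewrite hornerM hornerD hornerM !hornerC horner_exp hornerD hornerC hornerX.
rewrite XW -exprM mulrA -mulrBl; apply: dvdp_mulr.
have -> : f ^+ M * u j + eps%:P * v j * root_series.[W] - f ^+ M * (u j + v j * f ^+ E) =
  eps%:P * v j * (root_series.[W] - eps%:P * (f ^+ M * f ^+ E)).
  by rewrite mulrBr -[eps%:P * v j * (eps%:P * _)]mulrACA epsP_sqr; ring.
by apply: dvdp_mull; apply: root_series_horner.
Qed.

(** A series starting at order [M.+1] in Y takes at [W] a value divisible by [W ^+ M.+1]; the factor
    [f ^+ M] is then removed by coprimality. *)
Lemma dvdp_aux_poly : (forall i, (i <= M)%N -> aux_series`_i = 0) -> D ^+ M.+1 %| aux_poly.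
Proof.
move=> low.
have [c Dc] : exists c, aux_series = c * 'X^(M.+1).
  exists (drop_poly M.+1 aux_series); rewrite -{1}(poly_take_drop M.+1 aux_series).
  rewrite (_ : take_poly _ _ = 0) ?add0r //; apply/polyP => i.
  by rewrite coef_take_poly coef0 ltnS; case: leqP => // /low.
have := aux_series_horner; rewrite Dc hornerM hornerXn => dv.
have : D ^+ M.+1 %| f ^+ M * aux_poly.
  rewrite -(subKr (c.[W] * W ^+ M.+1) (f ^+ M * aux_poly)); apply: dvdp_sub dv.
  by rewrite dvdp_mull // dvdp_exp2r.
by rewrite Gauss_dvdpr // coprimep_expl // coprimep_expr // coprime_Df.
Qed.

Hypotheses (su : forall j, (size (u j) <= b.+1)%N) (sv : forall j, (size (v j) <= b.+1)%N).

Lemma aux_series_deg : coef_deg_le (M * n + b + J) aux_series.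
Proof.
apply: coef_deg_le_sum => j; apply: (@coef_deg_leW _ ((M * n + b) + j * 1)).
  by rewrite leq_add2l muln1 -ltnS.
apply: coef_deg_leM; last exact/coef_deg_leX/coef_deg_leXY.
apply: coef_deg_leD.
  apply: coef_deg_leC; rewrite (leq_trans (size_polyMleq _ _)) //.
  by rewrite (polySpred (expf_neq0 _ f0)) size_exp mulnC addSn /= -addnS leq_add2l su.
rewrite addnC; apply: coef_deg_leM; last exact: root_series_deg.
apply: coef_deg_leC; rewrite mul_polyC (leq_trans (size_scale_leq _ _)) //.
Qed.

Lemma aux_poly_size : (size aux_poly <= b.+1 + n * E + Q * J)%N.
Proof.
rewrite (leq_trans (size_sum _ _ _)) //; apply/bigmax_leqP => j _.
rewrite (leq_trans (size_polyMleq _ _)) // size_polyXn addnS /=.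
apply: leq_add; last by rewrite leq_mul2l -ltnS ltn_ord orbT.
rewrite (leq_trans (size_polyD _ _)) // geq_max (leq_trans (su j)) ?leq_addr //=.
rewrite (leq_trans (size_polyMleq _ _)) //.
by rewrite (polySpred (expf_neq0 _ f0)) size_exp addnS leq_add2r sv.
Qed.

(* Comparing [X^Q]-adic digits, [aux_poly = 0] forces the two-variable identity
   [k0^2 f(X) = f(Y) k1^2]; its leading coefficients in [Y] make [f] a square. *)
Lemma aux_poly_neq0 : (exists j, (u j != 0) || (v j != 0)) -> aux_poly != 0.
Proof.
move=> [j0 nz]; apply/eqP => R0.
pose k0 := \poly_(j < J.+1) u (inord j); pose k1 := \poly_(j < J.+1) v (inord j).
have k0j (j : 'I_J.+1) : k0`_j = u j by rewrite coef_poly ltn_ord inord_val.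
have k1j (j : 'I_J.+1) : k1`_j = v j by rewrite coef_poly ltn_ord inord_val.
have deg0 : coef_deg_le b k0.
  by move=> i; rewrite coef_poly; case: ifP; rewrite ?size_poly0 ?su.
have deg1 : coef_deg_le b k1.
  by move=> i; rewrite coef_poly; case: ifP; rewrite ?size_poly0 ?sv.
have Dk : k0.['X^Q] + k1.['X^Q] * f ^+ E = 0.
  rewrite -[RHS]R0 /k0 /k1 !horner_poly mulr_suml -big_split /=.
  apply: eq_bigr => j _; rewrite !inord_val exprM mulrDl; congr (_ + _).
  by rewrite mulrAC.
pose fY : {poly {poly F}} := map_poly polyC f.
have fYQ : fY.['X^Q] = f ^+ Q.
  by rewrite [f ^+ Q]exp_card_comp /comp_poly.
(* Squaring [Dk] and multiplying by [f] produces [f ^+ (2 * E + 1) = f ^+ Q], the value of [fY] at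
   ['X^Q]. Inner degrees stay at most [2 * b + n < Q], so digits can be compared. *)
have : k0 ^+ 2 * f%:P - fY * k1 ^+ 2 = 0.
  apply: (@horner_polyXn_eq0 _ Q); first by rewrite QE.
    move=> i; apply: (leq_trans _ bQ); move: i; apply: coef_deg_leD.
      apply: coef_deg_leM; first exact: coef_deg_leX.
      by apply: coef_deg_leC; rewrite -polySpred.
    apply: coef_deg_leN; rewrite addnC; apply: coef_deg_leM; last exact: coef_deg_leX.
    apply: (@coef_deg_leW _ 0) => // i.
    by rewrite coef_map size_polyC; case: eqP.
  rewrite hornerD hornerN (hornerM (k0 ^+ 2)) (hornerM fY) !horner_exp hornerC fYQ.
  move/eqP: Dk; rewrite addr_eq0 => /eqP->; rewrite sqrrN exprMn -exprM.
  have -> : f ^+ Q = f ^+ (E * 2) * f by rewrite -exprSr -QE.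
  by rewrite -mulrA [X in _ - X]mulrC subrr.
move/eqP; rewrite subr_eq0 => /eqP /(congr1 lead_coef).
rewrite (lead_coefM (k0 ^+ 2)) (lead_coefM fY) lead_coefC lead_coef_map_inj //; last exact: polyC_inj.
rewrite (monicP f_mon) mul1r !lead_coef_exp => Dl.
have lc0 : lead_coef k0 != 0.
  apply: contraTneq nz => lc.
  have k00 : k0 = 0 by apply/eqP; rewrite -lead_coef_eq0 lc.
  have k10 : k1 = 0.
    apply/eqP; rewrite -lead_coef_eq0 -sqrf_eq0 -Dl lc expr0n mul0r //.
  by rewrite -k0j -k1j k00 k10 !coef0 eqxx.
have /dvdpP[c Dc] : lead_coef k0 %| lead_coef k1.
  by rewrite -(@dvdp_pexp2r _ _ _ 2) // -Dl dvdp_mulr.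
apply: (f_nsq (l := c)); apply: (mulfI (expf_neq0 2 lc0)).
by rewrite Dl Dc exprMn mulrC.
Qed.

End Auxiliary.

(** A pigeonhole argument: by [count] there are more choices of coefficients than values of the
    low-order part of the series. That part is additive, so the difference of two colliding choices
    works. *)
Lemma exists_auxiliary : exists u v : 'I_J.+1 -> {poly F},
  [/\ forall j, (size (u j) <= b.+1)%N, forall j, (size (v j) <= b.+1)%N,
      exists j, (u j != 0) || (v j != 0) &
      forall i, (i <= M)%N -> (aux_series u v)`_i = 0].
Proof.
pose s := (M * n + b + J).+1.
pose T := {ffun 'I_J.+1 -> {poly_b.+1 F} * {poly_b.+1 F}}.
pose U (h : T) j : {poly F} := val (h j).1; pose V (h : T) j : {poly F} := val (h j).2.
have sU h j : (size (U h j) <= b.+1)%N by apply: size_npoly.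
have sV h j : (size (V h j) <= b.+1)%N by apply: size_npoly.
pose Phi (h : T) : {ffun 'I_M.+1 -> {poly_s F}} :=
  [ffun i : 'I_M.+1 => npolyp s (aux_series (U h) (V h))`_i].
have /injectivePn[x [y neq /ffunP eqPhi]] : ~~ injectiveb Phi.
  apply/negP => /injectiveP /leq_card.
  rewrite !card_ffun card_prod !card_npoly !card_ord -expnD -!expnM leq_exp2l //.
  rewrite leqNgt; apply/negP; rewrite negbK.
  by move: count; rewrite -/s; lia.
exists (fun j => U x j - U y j), (fun j => V x j - V y j); split=> [j|j||i iM].
- by rewrite (leq_trans (size_polyD _ _)) // size_polyN geq_max !sU.
- by rewrite (leq_trans (size_polyD _ _)) // size_polyN geq_max !sV.
- apply/existsP; apply: contraNT neq; rewrite negb_exists => /forallP all0.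
  apply/eqP/ffunP => j; have := all0 j; rewrite negb_or !negbK !subr_eq0.
  case/andP=> /eqP Dx /eqP Dy; rewrite [x j]surjective_pairing [y j]surjective_pairing.
  by congr (_, _); apply: val_inj.
have -> : aux_series (fun j => U x j - U y j) (fun j => V x j - V y j) =
    aux_series (U x) (V x) - aux_series (U y) (V y).
  rewrite /aux_series -sumrB; apply: eq_bigr => j _; rewrite -mulrBl; congr (_ * _).
  by rewrite !mulrBr !polyCB mulrBl; ring.
have /(congr1 val) := eqPhi (Ordinal (iM : (i < M.+1)%N)).
rewrite !ffunE /= !npolypK ?aux_series_deg // coefB => ->.
by rewrite subrr.
Qed.

(** The nonzero [aux_poly] is divisible by [D ^+ M.+1]; degrees are compared. *)
Lemma stepanov_degree : (M.+1 * (size D).-1 < b.+1 + n * E + Q * J)%N.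
Proof.
have [u [v [su sv nz low]]] := exists_auxiliary.
have R0 := aux_poly_neq0 su sv nz.
have dv := dvdp_aux_poly low.
apply: leq_trans (aux_poly_size su sv); apply: leq_trans (dvdp_leq R0 dv).
have DM0 : D ^+ M.+1 != 0 by apply: contraNneq R0 => D0; rewrite -dvd0p -D0.
by rewrite (polySpred DM0) size_exp mulnC.
Qed.

End Stepanov.

(** Parameters for [stepanov_degree]: [J.+1 = t = q ^ g], [b] as large as [2 * b + n < Q] permits,
    and vanishing order [M.+1 = 2 * t - r]. The leading terms then give [deg D] about [Q / 2]. *)
Lemma stepanov_bound (F : finFieldType) (f D : {poly F}) (g : nat) (eps : F)
    (q := #|F|) (n := (size f).-1) (Q := (q ^ (2 * g + 1))%N) :
  odd q -> (4 < q)%N -> (0 < n <= g)%N -> f \is monic ->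
  (forall l : {poly F}, f <> l ^+ 2) -> eps ^+ 2 = 1 ->
  D %| 'X^Q - 'X -> D %| f ^+ (Q.-1)./2 - eps%:P ->
  (2 * (size D).-1 <= Q + q ^ g.+1 * (3 * n + 1))%N.
Proof.
move=> q_odd q_gt4 /andP[n_gt0 n_le] f_mon f_nsq eps2 DW Df.
(* The defect [r] is such that [r (b+1)] outweighs the cost [2t (2tn + t)] of the
   degree growth_bound in the [2t - r] linear conditions. *)
pose t := (q ^ g)%N; pose r := (2 * n + 2)%N.
have DQ : Q = (q * (t * t))%N by rewrite /Q /t -expnD -expnS; congr (_ ^ _)%N; lia.
have t_ge : (2 * g + 2 <= t)%N.
  rewrite /t; elim: g {n_le DQ Q DW Df t} (leq_trans n_gt0 n_le) => // g' IH _.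
  case: g' IH => [|g'] IH; first by rewrite expn1; lia.
  by have := IH isT; rewrite [(q ^ g'.+2)%N]expnS; nia.
have rt : (r <= t)%N by rewrite /r; lia.
have Qt : (5 * (t * t) <= Q)%N by rewrite DQ leq_mul2r q_gt4 orbT.
have Qodd : odd Q by rewrite oddX q_odd orbT.
have tt : (t <= t * t)%N by rewrite leq_pmulr //; lia.
pose b := ((Q - n).-1)./2; pose M := (2 * t - r).-1; pose J := t.-1.
have MS : M.+1 = (2 * t - r)%N by rewrite prednK //; lia.
have JS : J.+1 = t by rewrite prednK //; lia.
have b_le : (2 * b + n < Q)%N by rewrite /b; lia.
have b_ge : (Q <= 2 * b.+1 + n)%N by rewrite /b; lia.
have B_ge : (2 * (t * t) <= b.+1)%N by lia.
have E_def : (2 * (Q.-1)./2 = Q.-1)%N by lia.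
have t4 : (4 * t <= t * t)%N by rewrite leq_mul2r; lia.
have ME : (M <= (Q.-1)./2)%N by lia.
have count : (M.+1 * (M * n + b + J).+1 < 2 * (J.+1 * b.+1))%N.
  have -> : ((M * n + b + J).+1 = M * n + J + b.+1)%N by lia.
  rewrite JS mulnDr [X in (_ < X)%N](_ : _ = (r + M.+1) * b.+1)%N; last first.
    by rewrite MS subnKC ?mulnA //; lia.
  rewrite mulnDl ltn_add2r.
  apply: (@leq_ltn_trans (2 * t * (2 * t * n + t))).
    by apply: leq_mul; [lia | apply: leq_add; [apply: leq_mul; lia | lia]].
  apply: (@leq_trans (r * (2 * (t * t)))); last by rewrite leq_mul2l B_ge orbT.
  have -> : (2 * t * (2 * t * n + t) = (2 * n + 1) * (2 * (t * t)))%N by ring.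
  by rewrite ltn_mul2r /r; lia.
have := @stepanov_degree F q_odd f D (2 * g + 1) eps _ f_mon f_nsq eps2 DW Df J b M b_le ME count.
rewrite -/q -/Q -/n MS addn1 => /(_ isT).
set x := (size D).-1 => main; rewrite leqNgt; apply/negP => x_gt.
(* As [r <= t], the factor [2 * t - r] is at least [t]. With [t * (q * t) = Q], the assumed excess
   contributes at least [Q * (3 * n + 1)], and [3 * n + 1 - r = n - 1]. *)
have low : (Q * (2 * t + n - 1) <= (2 * t - r) * (2 * x))%N.
  apply: (@leq_trans ((2 * t - r) * (Q + q * t * (3 * n + 1)))); last first.
    by rewrite leq_mul2l; apply/orP; right; apply: ltnW; rewrite -/t -expnS.
  rewrite mulnDr; apply: (@leq_trans ((2 * t - r) * Q + t * (q * t * (3 * n + 1)))).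
    have -> : (t * (q * t * (3 * n + 1)) = Q * (3 * n + 1))%N by rewrite DQ; ring.
    rewrite [((2 * t - r) * Q)%N]mulnC -mulnDr leq_mul2l; apply/orP; right; rewrite /r; lia.
  by rewrite leq_add2l leq_mul2r; apply/orP; right; lia.
have up : ((2 * t - r) * (2 * x) < Q * (2 * t + n - 1))%N.
  apply: (@leq_ltn_trans (2 * ((2 * t - r) * x))); first by rewrite mulnCA.
  have -> : (Q * (2 * t + n - 1) = 2 * (Q * J) + n * Q + Q)%N.
    by rewrite (_ : 2 * t + n - 1 = 2 * J + n + 1)%N; [ring | lia].
  have nE : (2 * (n * (Q.-1)./2) = n * Q - n)%N by rewrite mulnCA E_def -subn1 mulnBr muln1.
  have nQ : (n <= n * Q)%N by rewrite leq_pmulr //; lia.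
  lia.
by move: (leq_ltn_trans low up); rewrite ltnn.
Qed.

(** * Averages over primes *)

Section PrimeSums.
Variables (F : finFieldType) (g : nat).
Local Notation q := #|F|.
Local Notation N := (2 * g + 1)%N.
Local Notation Q := (q ^ N)%N.
Local Notation W := ('X^Q - 'X : {poly F}).
Hypotheses (q_odd : odd q) (q_gt4 : (4 < q)%N).

Definition prime_deg (P : {poly_(N.+1) F}) :=
  [&& val P \is monic, size (val P) == N.+1 & irreducibleb (val P)].

Local Notation prime_count := #|[pred P | prime_deg P]|.

Lemma prime_deg_mi P : prime_deg P -> monic_irreducible_poly (val P).
Proof. by case/and3P=> m _ /irreducibleP. Qed.

Lemma prime_deg_size P : prime_deg P -> size (val P) = N.+1.
Proof. by case/and3P=> _ /eqP. Qed.

Lemma size_big_prod_monic (I : Type) (r : seq I) (p : pred I) (G : I -> {poly F}) :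
  (forall i, p i -> G i \is monic) ->
  (size (\prod_(i <- r | p i) G i)).-1 = (\sum_(i <- r | p i) (size (G i)).-1)%N.
Proof.
move=> G_mon.
suff [] : (\prod_(i <- r | p i) G i) \is monic /\
    (size (\prod_(i <- r | p i) G i)).-1 = (\sum_(i <- r | p i) (size (G i)).-1)%N by [].
elim/big_rec2: _ => [|i s f /G_mon Gi [f_mon <-]]; first by rewrite monic1 size_poly1.
split; first by rewrite monicMl.
rewrite size_monicM ?monic_neq0 // (polySpred (monic_neq0 Gi)).
by rewrite (polySpred (monic_neq0 f_mon)) addnS.
Qed.

Lemma prime_prod_size (p : pred {poly_(N.+1) F}) :
  (size (\prod_(P | prime_deg P && p P) val P)).-1 = (N * #|[pred P | prime_deg P & p P]|)%N.
Proof.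
rewrite size_big_prod_monic; last by move=> P /andP[/prime_deg_mi[]].
rewrite (eq_bigr (fun=> N)); last by move=> P /andP[/prime_deg_size->].
by rewrite sum_nat_const mulnC.
Qed.

Lemma prime_prod_dvdp (p : pred {poly_(N.+1) F}) (a : {poly F}) :
  (forall P, prime_deg P -> p P -> val P %| a) ->
  \prod_(P | prime_deg P && p P) val P %| a.
Proof.
move=> dv; apply: dvdp_big_prod => [|P _ /andP[pP]|P R /andP[P_pr _] /andP[R_pr _] neq].
- exact: index_enum_uniq.
- exact: dv.
by apply: monic_irreducible_coprimep; rewrite ?val_eqE //; apply: prime_deg_mi.
Qed.

Lemma prime_dvdp_W P : prime_deg P -> val P %| W.
Proof.
by move=> P_pr; have := dvdp_fermat (prime_deg_mi P_pr); rewrite (prime_deg_size P_pr).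
Qed.

Let q_gt1 : (1 < q)%N. Proof. exact: finNzRing_gt1. Qed.
Let Q_gt1 : (1 < Q)%N. Proof. by rewrite (leq_trans q_gt1) // -{1}(expn1 q) leq_exp2l ?addn1. Qed.

Let size_W : size W = Q.+1.
Proof. by rewrite size_polyDl ?size_polyXn // size_polyN size_polyX !ltnS. Qed.

Let W_monic : W \is monic.
Proof. by rewrite monicE lead_coefDl ?lead_coefXn // size_polyXn size_polyN size_polyX !ltnS. Qed.

(** The product of these primes divides [W], of degree [Q]. *)
Lemma prime_count_le : (N * prime_count <= Q)%N.
Proof.
have := prime_prod_size xpredT; set D := (X in size X) => sD.
have : D %| W by apply: prime_prod_dvdp => P P_pr _; apply: prime_dvdp_W.
move/(dvdp_leq (monic_neq0 W_monic)); rewrite size_W => sDQ.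
have -> : prime_count = #|[pred P | prime_deg P & true]|.
  by apply: eq_card => P; rewrite !inE andbT.
by rewrite -sD; case: (size D) sDQ.
Qed.

(** [W] is squarefree and its irreducible factors have degree dividing [N], hence equal to [N] or at
    most [g]. The latter number at most [q ^ g.+1], the count of all polynomials of degree at most
    [g]. *)
Lemma prime_count_ge : (Q <= N * prime_count + g * q ^ g.+1)%N.
Proof.
pose Z1 := \prod_(P | prime_deg P && true) val P.
pose Z2 := \prod_(R : {poly_(g.+1) F} | monic_irreducible (val R)) val R.
have Z1_mon : Z1 \is monic by apply: monic_prod => P /andP[/prime_deg_mi[]].
have Z2_mon : Z2 \is monic by apply: monic_prod => P /monic_irreducibleP[].
have : W %| Z1 * Z2.
  rewrite [X in X %| _](monic_factorization W_monic).
  apply: dvdp_big_prod => [|R _ /monic_irreducibleP R_mi|R S /monic_irreducibleP R_mi /monic_irreducibleP S_mi neq].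
  - exact: index_enum_uniq.
  - set m := multiplicity _ _.
    have dvm : val R ^+ m %| W by apply: dvdp_multiplicity => //; apply: monic_neq0.
    have m_le1 : (m <= 1)%N.
      rewrite leqNgt; apply/negP => m_gt1.
      have : val R %| 1.
        apply: (@sqr_ndvdp_frobenius F N); first by rewrite addn1.
        exact: dvdp_trans (dvdp_exp2l _ m_gt1) dvm.
      by rewrite dvdp1; have [[]] := R_mi; case: (size _) => [|[]].
    case Dm: m m_le1 dvm => [|[|//]] _; first by rewrite expr0 !dvd1p.
    rewrite expr1 => RW; have := dvdp_frobenius_dvdn R_mi RW; set d := (size _).-1 => dN.
    have sR : size (val R) = d.+1 by rewrite /d prednK // ltnW // R_mi.1.1.
    have [dN'|dg] : d = N \/ (d <= g)%N.
      case/dvdnP: dN => [[|[|c]]]; [lia | by rewrite mul1n; left | right; nia].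
    + apply: dvdp_mulr; rewrite /Z1 (bigD1 (npolyp N.+1 (val R))) /=; last first.
        rewrite /prime_deg /= npolypK ?sR ?dN' // R_mi.2 eqxx andbT /=.
        exact/irreducibleP/R_mi.1.
      by rewrite npolypK ?sR ?dN' // dvdp_mulr.
    apply: dvdp_mull; rewrite /Z2 (bigD1 (npolyp g.+1 (val R))) /=; last first.
      by rewrite npolypK ?sR ?ltnS // monic_irreducibleI.
    by rewrite npolypK ?sR ?ltnS // dvdp_mulr.
  by apply/coprimep_expl/coprimep_expr/monic_irreducible_coprimep; rewrite ?val_eqE.
have Z0 : Z1 * Z2 != 0 by rewrite mulf_neq0 ?monic_neq0.
move/(dvdp_leq Z0); rewrite size_W size_monicM ?monic_neq0 //.
have sZ1 : (size Z1).-1 = (N * prime_count)%N.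
  rewrite prime_prod_size; congr (_ * _)%N; by apply: eq_card => P; rewrite !inE andbT.
have sZ2 : ((size Z2).-1 <= g * q ^ g.+1)%N.
  rewrite size_big_prod_monic; last by move=> R /monic_irreducibleP[].
  rewrite -(card_npoly F g.+1) mulnC -sum_nat_const big_mkcond /=; apply: leq_sum => R _.
  by case: ifP => // _; have := size_npoly R; case: (size _).
have := polySpred (monic_neq0 Z1_mon); have := polySpred (monic_neq0 Z2_mon).
move=> -> ->; rewrite sZ1; move: sZ2.
by move: (N * prime_count)%N (size Z2).-1 (g * _)%N Q => a b c d; lia.
Qed.

(** Stepanov's method bounds the primes of each sign from above by about half of the total. Their
    sum is bounded below by [prime_count_ge], so neither class can be much smaller than the
    other. *)
Lemma prime_char_sum_bound (f : {poly F}) : f \is monic -> ((size f).-1 <= g)%N ->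
  (forall l : {poly F}, f <> l ^+ 2) ->
  `|N%:Z * \sum_(P | prime_deg P) qr_symbol f (val P)| <= (q ^ g.+1 * (4 * g + 1))%N%:Z.
Proof.
move=> f_mon f_le f_nsq; have f0 := monic_neq0 f_mon.
have n_gt0 : (0 < (size f).-1)%N.
  rewrite lt0n; apply/eqP => sf; apply: (f_nsq 1); rewrite expr1n.
  have /size1_polyC fC : (size f <= 1)%N by rewrite (polySpred f0) sf.
  by move: f_mon; rewrite fC monicE lead_coefC => /eqP->.
pose cnt (z : int) := #|[pred P | prime_deg P & qr_symbol f (val P) == z]|.
have bound (z : int) (eps : F) : eps ^+ 2 = 1 -> z%:~R = eps ->
    (2 * (N * cnt z) <= Q + q ^ g.+1 * (3 * g + 1))%N.
  move=> eps2 zeps; rewrite -prime_prod_size.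
  set D := \prod_(P | _) _.
  apply: (@leq_trans (Q + q ^ g.+1 * (3 * (size f).-1 + 1))); last first.
    by rewrite leq_add2l leq_mul2l leq_add2r leq_mul2l f_le !orbT.
  apply: (@stepanov_bound F f D g eps) => //; rewrite ?n_gt0 //.
    by apply: prime_prod_dvdp => P P_pr _; apply: prime_dvdp_W.
  apply: prime_prod_dvdp => P P_pr /eqP Dz.
  have := euler_dvdp q_odd (prime_deg_mi P_pr) f.
  by rewrite (prime_deg_size P_pr) Dz -zeps rmorph_int.
have b1 := bound 1 1 (expr1n _ _) (erefl _).
have bN := bound (-1) (-1) (sqrr_sign _ 1) (mulrN1z _).
have ndv P : prime_deg P -> ~~ (val P %| f).
  move=> P_pr; apply/negP => /(dvdp_leq f0).
  by rewrite (prime_deg_size P_pr) (polySpred f0); lia.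
have tot : (cnt 1%R + cnt (-1)%R = prime_count)%N.
  rewrite -(cardID [pred P | qr_symbol f (val P) == 1] [pred P | prime_deg P]).
  congr (_ + _)%N; apply: eq_card => P; rewrite !inE //.
  case P_pr: (prime_deg P); rewrite ?andbF //= andbT.
  have := ndv _ P_pr; rewrite -qr_eq0; have := qr_sign_values f (val P).
  by rewrite !inE => /or3P[] /eqP->.
have -> : \sum_(P | prime_deg P) qr_symbol f (val P) = (cnt 1)%:Z - (cnt (-1))%:Z.
  rewrite /cnt -!sum1_card !(big_morph Posz PoszD (erefl _)) /=.
  rewrite [X in _ = X - _]big_mkcondr [X in _ = _ - X]big_mkcondr /= -sumrB.
  apply: eq_bigr => P P_pr.
  have := ndv _ P_pr; rewrite -qr_eq0; have := qr_sign_values f (val P).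
  by rewrite !inE => /or3P[] /eqP->.
have := prime_count_ge; rewrite -tot.
move: b1 bN; rewrite (_ : 4 * g + 1 = (3 * g + 1) + g)%N; last by lia.
rewrite !mulnDr [(g * _)%N]mulnC mulrBr -!PoszM.
set x := (N * cnt 1%R)%N; set y := (N * cnt (-1)%R)%N; set A := (q ^ g.+1 * (3 * g))%N.
set B := (q ^ g.+1 * 1)%N; set C := (q ^ g.+1 * g)%N; set Q' := Q.
by move: x y A B C Q' => x y A B C Q'; lia.
Qed.

End PrimeSums.

(** * Counting monic squares and averaging over primes *)

Section SquareCount.
Variable F : finFieldType.
Local Notation q := #|F|.
Hypothesis q_odd : odd q.

Definition is_square n (v : {poly_n F}) :=
  [exists l : {poly_n.+1 F}, monic_of n (val v) == val l ^+ 2].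

Lemma is_squareP n (v : {poly_n F}) :
  reflect (exists l : {poly F}, monic_of n (val v) = l ^+ 2) (is_square v).
Proof.
apply: (iffP existsP) => [[l /eqP]|[l Dl]]; first by exists (val l).
have l0 : l != 0 by apply: contra_eq_neq Dl => ->; rewrite expr0n monic_neq0 ?monic_monic_of.
exists (npolyp n.+1 l); rewrite /= npolypK ?Dl //.
rewrite -(size_monic_of v) Dl dvdp_leq ?expf_neq0 // expr2 dvdp_mulr //.
Qed.

Lemma monic_sqr_inj (a b : {poly F}) : a \is monic -> b \is monic ->
  a ^+ 2 = b ^+ 2 -> a = b.
Proof.
move=> a_mon b_mon /eqP; rewrite eqf_sqr => /orP[/eqP // | /eqP Dab].
have := monicP a_mon; rewrite Dab lead_coefN (monicP b_mon) => /eqP.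
by rewrite -subr_eq0 -opprD oppr_eq0 (negbTE (two_neq0 q_odd)).
Qed.

(** Squaring is injective on monic polynomials of degree [n./2], and any square root can be made
    monic because its leading coefficient squares to 1. *)
Lemma card_is_square n :
  #|[pred v : {poly_n F} | is_square v]| = (if odd n then 0 else q ^ n./2)%N.
Proof.
have size_sqr (l : {poly F}) : l != 0 -> size (l ^+ 2) = ((size l).-1 * 2).+1.
  by move=> l0; rewrite (polySpred (expf_neq0 2 l0)) size_exp.
case: ifP => n_odd.
  apply: eq_card0 => v; rewrite !inE; apply/is_squareP => -[l Dl].
  have l0 : l != 0 by apply: contra_eq_neq Dl => ->; rewrite expr0n monic_neq0 ?monic_monic_of.
  have := size_monic_of v; rewrite Dl size_sqr // => -[Dn].
  by move: n_odd; rewrite -Dn muln2 odd_double.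
set m := n./2; have Dn : n = (m * 2)%N by rewrite muln2 -[LHS]odd_double_half n_odd.
pose sq (w : {poly_m F}) := npolyp n (monic_of m (val w) ^+ 2 - 'X^n).
have size_msq (w : {poly_m F}) : size (monic_of m (val w) ^+ 2) = n.+1.
  by rewrite size_sqr ?monic_neq0 ?monic_monic_of // size_monic_of -Dn.
have sqE w : monic_of n (val (sq w)) = monic_of m (val w) ^+ 2.
  rewrite /= npolypK; first by rewrite /monic_of addrC subrK.
  by apply: size_sub_monic; rewrite ?size_msq // monic_exp ?monic_monic_of.
have sq_inj : injective sq.
  move=> w w' /(congr1 (fun v => monic_of n (val v))); rewrite !sqE.
  move/monic_sqr_inj => /(_ (monic_monic_of _) (monic_monic_of _)) /addrI.
  exact: val_inj.
rewrite -(card_npoly F m) -(card_imset _ sq_inj); apply: eq_card => v.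
rewrite !inE; apply/is_squareP/imsetP => [[l Dl]|[w _ ->]]; last first.
  by exists (monic_of m (val w)); rewrite sqE.
have l0 : l != 0 by apply: contra_eq_neq Dl => ->; rewrite expr0n monic_neq0 ?monic_monic_of.
pose c := lead_coef l; have c0 : c != 0 by rewrite lead_coef_eq0.
have c2 : c ^+ 2 = 1.
  by rewrite -lead_coef_exp -Dl (monicP (monic_monic_of _)).
have sl : size (c^-1 *: l) = m.+1.
  rewrite size_scale ?invr_eq0 // (polySpred l0); congr _.+1.
  have := size_monic_of v; rewrite Dl size_sqr // => -[e].
  by apply/eqP; rewrite -(eqn_pmul2r (ltn0Sn 1)) e -Dn.
have l_mon : c^-1 *: l \is monic by rewrite monicE lead_coefZ mulVf.
exists (npolyp m (c^-1 *: l - 'X^m)) => //; apply: val_inj.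
apply: (@addrI _ 'X^n); rewrite -[LHS]/(monic_of n (val v)) -[RHS]/(monic_of n (val (sq _))).
rewrite sqE /= npolypK ?size_sub_monic // /monic_of [X in X ^+ 2]addrC subrK.
by rewrite exprZn exprVn c2 invr1 scale1r.
Qed.

End SquareCount.

Section Average.
Variables (F : finFieldType) (g : nat).
Local Notation q := #|F|.
Local Notation N := (2 * g + 1)%N.
Hypotheses (q_odd : odd q) (q_gt4 : (4 < q)%N).

(** After exchanging the sums, each square contributes 1 per prime, since its degree is below [N].
    The nonsquares, at most [q ^ n], fall under [prime_char_sum_bound]. *)
Lemma average_monic_sum n : (n <= g)%N ->
  `|N%:Z * (\sum_(P : {poly_(N.+1) F} | prime_deg P) monic_sum (val P) n)
    - (if odd n then 0 else (N * #|[pred P : {poly_(N.+1) F} | prime_deg P]| * q ^ n./2)%N%:Z)|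
  <= (q ^ n * (q ^ g.+1 * (4 * g + 1)))%N%:Z.
Proof.
move=> n_le; rewrite /monic_sum exchange_big /= mulr_sumr (bigID (@is_square F n)) /=.
set S1 := (X in X + _ - _); set S2 := (X in _ + X - _).
have -> : S1 = if odd n then 0 else (N * #|[pred P : {poly_(N.+1) F} | prime_deg P]| * q ^ n./2)%N%:Z.
  rewrite /S1 (eq_bigr (fun=> (N * #|[pred P : {poly_(N.+1) F} | prime_deg P]|)%N%:Z)).
    rewrite sumr_const card_is_square //; case: ifP => // _.
    by rewrite -mulr_natr natz -PoszM.
  move=> v /is_squareP[l Dl]; rewrite PoszM; congr (_ * _).
  rewrite (eq_bigr (fun=> 1)) ?sumr_const ?natz // => P P_pr; rewrite Dl.
  rewrite (qrX q_odd (prime_deg_mi P_pr)) qr_sqr //.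
  apply/negP => Pl; have : val P %| monic_of n (val v) by rewrite Dl expr2 dvdp_mulr.
  move/(dvdp_leq (monic_neq0 (monic_monic_of v))).
  by rewrite size_monic_of (prime_deg_size P_pr); lia.
rewrite addrAC subrr add0r /S2 (le_trans (ler_norm_sum _ _ _)) //.
rewrite PoszM -(card_npoly F n) -[#|_|%:Z]natz -sumr_const mulr_suml.
rewrite big_mkcond /=; apply: ler_sum => v _; rewrite mul1r; case: ifP => // nsq.
apply: prime_char_sum_bound => //; first exact: monic_monic_of.
  by rewrite size_monic_of.
by move=> l Dl; case/negP: nsq; apply/is_squareP; exists l.
Qed.

End Average.

(** * The first moment *)

Lemma char_sum_monic_sum (F : finFieldType) (P : {poly F}) n :
  odd #|F| -> (#|F| %% 4 = 1)%N -> monic_irreducible_poly P ->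
  char_sum P n = monic_sum P n.
Proof.
move=> q_odd q4 P_mi; rewrite /char_sum /monic_sum -(big_monic n (fun f => qr_symbol f P)).
by apply: eq_bigr => f /andP[f_mon _]; rewrite chi_qr.
Qed.

Section Assembly.
Variables (F : finFieldType) (g : nat) (K : realFieldType) (s : K).
Local Notation q := #|F|.
Local Notation N := (2 * g + 1)%N.
Hypotheses (q_odd : odd q) (q_gt4 : (4 < q)%N) (s_gt0 : 0 < s) (s_sqr : s ^+ 2 = q%:R).

Let s_neq0 : s != 0. Proof. by rewrite gt_eqF. Qed.
Let natq k : (q ^ k)%:R = s ^+ (2 * k) :> K. Proof. by rewrite natrX -s_sqr exprM. Qed.

Let s_ge1 : 1 <= s.
Proof.
rewrite leNgt; apply/negP => s_lt1.
have : s ^+ 2 < 1 by rewrite expr_lt1 // ltW.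
by rewrite s_sqr ltrn1 ltnNge (ltnW (ltn_trans _ q_gt4)).
Qed.

(** The functional equation folds the terms with [n > g] onto those with [n < g], the index
    [2 * g - i] going to [i]; the weights match because [s ^+ 2 = q]. *)
Lemma reflect_L (P : {poly F}) : monic_irreducible_poly P -> size P = N.+1 ->
  \sum_(n < N) (monic_sum P n)%:~R * s^-1 ^+ n =
  \sum_(n < g.+1) (monic_sum P n)%:~R * s^-1 ^+ n + \sum_(n < g) (monic_sum P n)%:~R * s^-1 ^+ n :> K.
Proof.
move=> P_mi sP.
rewrite -(big_mkord xpredT (fun n => (monic_sum P n)%:~R * s^-1 ^+ n)) (@big_cat_nat _ _ _ g.+1) //=; last by lia.
rewrite !big_mkord; congr (_ + _).
rewrite -{1}[g.+1]add0n big_addn (_ : N - g.+1 = g)%N; last by lia.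
rewrite big_mkord (reindex_inj rev_ord_inj) /=; apply: eq_bigr => i _.
have gi := ltn_ord i.
rewrite (_ : g - i.+1 + g.+1 = 2 * g - i)%N; last by lia.
have iN : (i < N)%N by lia.
have := monic_sum_functional_equation q_odd P_mi sP iN.
move/(congr1 (fun z : int => z%:~R : K)); rewrite !rmorphMn /= -!(mulr_natr (_%:~R)) !natq => H.
have nz : s ^+ (2 * i) != 0 by rewrite expf_neq0.
apply: (mulIf nz); rewrite mulrAC -H.
rewrite -!mulrA; congr (_ * _); rewrite !exprVn.
have /esym De : (2 * g - i + i = 2 * g)%N by lia.
rewrite {1}De exprD mulrAC mulfV ?expf_neq0 // mul1r.
by rewrite mul2n -addnn exprD mulrA mulVf ?mul1r ?expf_neq0.
Qed.

(** Each even [n] in either range contributes [N * pi_N], close to [q ^ N], so the total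
    multiplicity [g.+1 = (N + 1)/2] is the constant of the main term. *)
Lemma even_count : (\sum_(n < g.+1) ~~ odd n + \sum_(n < g) ~~ odd n = g.+1)%N.
Proof.
pose S k := (\sum_(n < k) ~~ odd n)%N; rewrite -/(S g) -/(S g.+1).
have SS k : S k.+1 = (S k + ~~ odd k)%N by rewrite /S big_ord_recr.
elim: g => [|k IH]; first by rewrite SS /S !big_ord0.
by move: IH; rewrite !SS /=; case: (odd k); lia.
Qed.

Local Notation pi_N := #|[pred P : {poly_(N.+1) F} | prime_deg P]|.

(** The weight [s^-1 ^+ n] cancels the [q ^ n./2] squares for even [n], and reduces the error factor
    [q ^ n] to [s ^+ n <= s ^+ g]. *)
Lemma average_term n : (n <= g)%N ->
  `|\sum_(P : {poly_(N.+1) F} | prime_deg P) N%:R * ((monic_sum (val P) n)%:~R * s^-1 ^+ n)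
     - (~~ odd n * (N * pi_N))%N%:R| <= s ^+ g * (q ^ g.+1 * (4 * g + 1))%N%:R :> K.
Proof.
move=> n_le; have := average_monic_sum q_odd q_gt4 n_le.
rewrite -(ler_int K) intr_norm /= rmorphB rmorphM rmorph_sum /=.
set T := \sum_(P | _) _; set B := (q ^ g.+1 * _)%N.
have -> : \sum_(P : {poly_(N.+1) F} | prime_deg P) N%:R * ((monic_sum (val P) n)%:~R * s^-1 ^+ n)
   = (N%:R * T) * s^-1 ^+ n by rewrite -mulrA mulr_suml mulr_sumr.
have sn_gt0 : 0 < s ^+ n by rewrite exprn_gt0.
have -> : (~~ odd n * (N * pi_N))%N%:R =
    (if odd n then 0 else (N * pi_N * q ^ n./2)%N%:Z)%:~R * s^-1 ^+ n :> K.
  case n_odd: (odd n); first by rewrite !mul0r.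
  rewrite /= mul1n -pmulrn [in RHS]natrM natq.
  have -> : (2 * n./2 = n)%N by rewrite mul2n -[RHS]odd_double_half n_odd.
  by rewrite exprVn mulfK ?expf_neq0.
have rn_ge0 : 0 <= s^-1 ^+ n by rewrite exprn_ge0 // invr_ge0 ltW.
rewrite -mulrBl normrM [`|s^-1 ^+ n|]ger0_norm // => le.
apply: le_trans (ler_wpM2r rn_ge0 le) _.
rewrite -pmulrn natrM natq mulrAC ler_wpM2r // exprVn mul2n -addnn exprD mulfK ?expf_neq0 //.
by rewrite ler_weXn2l.
Qed.

Lemma weighted_sum_bound :
  `|\sum_(P : {poly_(N.+1) F} | prime_deg P) N%:R * (\sum_(n < N) (monic_sum (val P) n)%:~R * s^-1 ^+ n)
    - (q ^ N)%:R * g.+1%:R| <= 9%:R * q%:R * g.+1%:R ^+ 2 * s ^+ (3 * g) :> K.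
Proof.
pose X n := \sum_(P : {poly_(N.+1) F} | prime_deg P) N%:R * ((monic_sum (val P) n)%:~R * s^-1 ^+ n).
pose m n : K := (~~ odd n * (N * pi_N))%N%:R.
pose B : K := s ^+ g * (q ^ g.+1 * (4 * g + 1))%N%:R.
have -> : \sum_(P : {poly_(N.+1) F} | prime_deg P) N%:R * (\sum_(n < N) (monic_sum (val P) n)%:~R * s^-1 ^+ n)
   = \sum_(n < g.+1) X n + \sum_(n < g) X n.
  rewrite (eq_bigr (fun P : {poly_(N.+1) F} => \sum_(n < g.+1) N%:R * ((monic_sum (val P) n)%:~R * s^-1 ^+ n)
     + \sum_(n < g) N%:R * ((monic_sum (val P) n)%:~R * s^-1 ^+ n))).
    by rewrite big_split /= exchange_big [X in _ + X]exchange_big.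
  move=> P P_pr; rewrite reflect_L ?(prime_deg_size P_pr) //; last exact: prime_deg_mi.
  by rewrite mulrDr !mulr_sumr.
have main : \sum_(n < g.+1) m n + \sum_(n < g) m n = g.+1%:R * (N * pi_N)%N%:R.
  by rewrite -!natr_sum -natrD -!big_distrl -mulnDl even_count natrM.
have part k : (k <= g.+1)%N -> `|\sum_(n < k) X n - \sum_(n < k) m n| <= k%:R * B.
  move=> kg; rewrite -sumrB (le_trans (ler_norm_sum _ _ _)) //.
  rewrite mulr_natl -[X in _ *+ X]card_ord -sumr_const; apply: ler_sum => i _.
  by apply: average_term; rewrite -ltnS (leq_trans _ kg).
have B_ge0 : 0 <= B by rewrite mulr_ge0 ?ler0n // exprn_ge0 // ltW.
have p1 := part _ (leqnn _); have p2 := part _ (leqnSn g).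
(* The cost of replacing [N * pi_N] by [q ^ N] in the main term. *)
have cnt : `|g.+1%:R * (N * pi_N)%N%:R - (q ^ N)%:R * g.+1%:R| <= g.+1%:R * (g * q ^ g.+1)%N%:R :> K.
  rewrite mulrC -mulrBl normrM [`|g.+1%:R|]ger0_norm ?ler0n // mulrC ler_wpM2l ?ler0n //.
  have lo : (q ^ N)%:R <= (N * pi_N)%N%:R + (g * q ^ g.+1)%N%:R :> K.
    by rewrite -natrD ler_nat prime_count_ge.
  have hi : (N * pi_N)%N%:R <= (q ^ N)%:R :> K by rewrite ler_nat prime_count_le.
  have e_ge0 : 0 <= (g * q ^ g.+1)%N%:R :> K by rewrite ler0n.
  by rewrite ler_norml; apply/andP; split; lra.
have sg : 1 <= s ^+ g by rewrite exprn_ege1.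
(* The constant 9 comes from [(2g + 1)(4g + 1) + (g + 1)g <= 9 (g + 1)^2]; [s ^+ g >= 1] lets the
   last term join the others. *)
have eB : (g.+1%:R * B) + (g%:R * B) + g.+1%:R * (g * q ^ g.+1)%N%:R <= 9%:R * q%:R * g.+1%:R ^+ 2 * s ^+ (3 * g).
  have -> : s ^+ (3 * g) = s ^+ g * (q ^ g)%:R by rewrite natq -exprD; congr (_ ^+ _); lia.
  apply: (@le_trans _ _ (s ^+ g * ((g.+1 + g) * (q ^ g.+1 * (4 * g + 1)) + g.+1 * (g * q ^ g.+1))%N%:R)).
    rewrite /B [in X in _ <= X]natrD mulrDr lerD //.
      by rewrite -mulrDl -natrD mulrCA -natrM.
    by rewrite -natrM ler_peMl ?ler0n.
  have -> : 9%:R * q%:R * g.+1%:R ^+ 2 * (s ^+ g * (q ^ g)%:R) = s ^+ g * (9 * q * (g.+1 ^ 2) * q ^ g)%N%:R.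
    by rewrite !natrM natrX; ring.
  rewrite ler_pM2l ?exprn_gt0 // ler_nat.
  by rewrite expnS; move: (q ^ g)%N q => x y; nia.
apply: le_trans eB.
rewrite (_ : _ - _ = (\sum_(n < g.+1) X n - \sum_(n < g.+1) m n) + (\sum_(n < g) X n - \sum_(n < g) m n)
   + (g.+1%:R * (N * pi_N)%N%:R - (q ^ N)%:R * g.+1%:R)); last by rewrite -main; ring.
rewrite (le_trans (ler_normD _ _)) // lerD // (le_trans (ler_normD _ _)) // lerD //.
Qed.

End Assembly.

Lemma int_to_RE (z : int) : int_to_R z = z%:~R.
Proof. by case: z => n; rewrite /int_to_R INRE // RoppE NegzE rmorphN. Qed.

Lemma weighted_LsumE (F : finFieldType) (g : nat) :
  odd #|F| -> (#|F| %% 4 = 1)%N ->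
  weighted_Lsum F g =
  \sum_(P : {poly_((2 * g + 1).+1) F} | prime_deg P)
    (2 * g + 1)%N%:R * (\sum_(n < 2 * g + 1) (monic_sum (val P) n)%:~R * (sqrt (qR F))^-1 ^+ n).
Proof.
move=> q_odd q4; rewrite /weighted_Lsum; apply: eq_big => [P|P P_pr].
  by rewrite /prime_deg -andbA.
have {}P_pr : prime_deg P by rewrite /prime_deg andbA.
rewrite INRE RmultE; congr (_ * _); rewrite /L_half (prime_deg_size P_pr).
apply: eq_bigr => n _; rewrite RmultE RpowE RinvE int_to_RE.
by rewrite char_sum_monic_sum //; apply: prime_deg_mi.
Qed.

Theorem theorem2p4 (F : finFieldType)
  (Hodd : odd #|F|) (Hq4 : (#|F| %% 4 = 1)%N) :
  forall eps : R, Rlt R0 eps ->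
  exists C : R, exists g0 : nat, forall g : nat, (g0 <= g)%N ->
    Rle
      (Rabs (Rminus (weighted_Lsum F g)
         (Rmult (Rdiv (pow (qR F) (2 * g + 1)) 2) (Rplus (INR (2 * g + 1)) 1))))
      (Rmult C (Rpower (pow (qR F) (2 * g + 1)) (Rplus (Rdiv 3 4) eps))).
Proof.
move=> eps eps_gt0.
have q_gt4 : (4 < #|F|)%N by have := finNzRing_gt1 F; rewrite -[#|_|]/#|F|; lia.
have q_gt1 : Rlt 1 (qR F).
  by apply/RltP; rewrite /qR INRE ltr1n ltnW // ltnW // ltnW.
have [C [C_ge0 growthC]] := growth_bound (qR F) eps q_gt1 eps_gt0.
exists (9%:R * qR F * C), 0%N => g _.
have s_gt0 : 0 < sqrt (qR F).
  by apply/RltP/sqrt_lt_R0/RltP; rewrite /qR INRE ltr0n ltnW // ltnW // ltnW // ltnW.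
have s_sqr : sqrt (qR F) ^+ 2 = #|F|%:R.
  rewrite expr2 -RmultE sqrt_sqrt; first by rewrite /qR INRE.
  by apply/RleP; rewrite /qR INRE ler0n.
have := weighted_sum_bound g Hodd q_gt4 s_gt0 s_sqr.
rewrite -weighted_LsumE // => bound.
apply/RleP; rewrite RabsE RminusE.
(* Here [N + 1 = 2 * g.+1], which cancels the division by 2. *)
have -> : Rmult (Rdiv (pow (qR F) (2 * g + 1)) 2) (Rplus (INR (2 * g + 1)) 1) =
    (#|F| ^ (2 * g + 1))%N%:R * g.+1%:R.
  rewrite RmultE RdivE RplusE RpowE /qR !INRE natrX.
  rewrite (IZRposE 2) INRE R1E natr1 (_ : (2 * g + 1).+1 = 2 * g.+1)%N; last by lia.
  by rewrite [in LHS]natrM mulrA divfK // pnatr_eq0.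
apply: le_trans bound _.
rewrite RmultE -/(qR F) -[#|F|%:R]INRE -/(qR F) -!mulrA !ler_pM2l ?ltr0n //; last first.
  by apply/RltP; apply: Rlt_trans q_gt1; apply: Rlt_0_1.
have /RleP := growthC g; rewrite RmultE RmultE !RpowE RplusE INRE.
by rewrite ?R1E natr1 expr2 -mulrA.
Qed.
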